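(* Let $T=(F,E,p,q)$ be a left-resolving textile system such that $F,E$ are finite graphs, $E$ is sink-free and $p$ is surjective. Let $\mathsf{k}$ be any field. Then the textile $\mathsf{k}$-algebra $\mathbf{A}(T)$ is isomorphic to the Steinberg algebra $A_{\mathsf{k}}(\mathcal{G}_T)$ as $\mathbb{Z}^2$-graded algebras.
   Context: A directed graph is written $E=(E^0,E^1,r_E,s_E)$ (vertices, edges, range, source); it is sink-free if every vertex emits an edge. A graph homomorphism $f:F\to E$ is a pair $(f^0,f^1)$, $f^i:F^i\to E^i$, commuting with ranges and sources (superscripts are often dropped); it is surjective if both $f^0,f^1$ are. A textile system is $T=(F,E,p,q)$ with $F,E$ directed graphs and $p,q:F\to E$ graph homomorphisms such that $f\mapsto (s_F(f),r_F(f),p(f),q(f))$ is injective on $F^1$. A homomorphism $p:F\to E$ has unique $r$-path lifting (resp. unique $s$-path lifting) if whenever $v\in F^0$, $e\in E^1$ and $p^0(v)=r_E(e)$ (resp. $p^0(v)=s_E(e)$), there is a unique $f\in F^1$ with $r_F(f)=v$ (resp. $s_F(f)=v$) and $p^1(f)=e$. $T$ is left-resolving if $p$ has unique $r$-path lifting and $q$ has unique $s$-path lifting. The textile algebra $\mathbf{A}(T)$ is the associative (not necessarily unital) $\mathsf{k}$-algebra generated by $E^0\cup F^0\cup E^1\cup\{w^*\mid w\in F^0\}\cup\{e^*\mid e\in E^1\}$ subject to: (T1) $uv=\delta_{u,v}u$ for $u,v\in E^0$; (T2) $s_E(e)e=e=e\,r_E(e)$ and $r_E(e)e^*=e^*=e^*s_E(e)$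 for $e\in E^1$; $p(w)w=w=w\,q(w)$ and $q(w)w^*=w^*=w^*p(w)$ for $w\in F^0$; (T3) $e^*e'=\delta_{e,e'}r_E(e)$ for $e,e'\in E^1$; $w^*w'=\delta_{w,w'}q(w)$ for $w,w'\in F^0$; (T4) $u=\sum_{e\in s_E^{-1}(u)}ee^*$ for $u\in E^0$ with $0<|s_E^{-1}(u)|<\infty$; $v=\sum_{w\in F^0,\,p(w)=v}ww^*$ for $v\in E^0$ with $0<|(p^0)^{-1}(v)|<\infty$; (T5) $we=e'w'$ and $e^*w^*=w'^*e'^*$ whenever there is $f\in F^1$ with $w=s_F(f)$, $w'=r_F(f)$, $e=q(f)$, $e'=p(f)$. It is $\mathbb{Z}^2$-graded by $\deg v=0$, $\deg w=\mathbf{e}_2$, $\deg e=\mathbf{e}_1$, $\deg w^*=-\mathbf{e}_2$, $\deg e^*=-\mathbf{e}_1$ for $v\in E^0,w\in F^0,e\in E^1$. $\mathbb{N}$ includes $0$. $\mathsf{X}_T^+:=\{x:\mathbb{N}^2\to F^1 \mid r_F(x_{\mathbf n})=s_F(x_{\mathbf n+\mathbf e_1}),\ q(x_{\mathbf n})=p(x_{\mathbf n+\mathbf e_2})\ \forall \mathbf n\in\mathbb{N}^2\}$, with the topology induced from the product of discrete spaces; $(\sigma_{\mathbf n}(x))_{\mathbf m}=x_{\mathbf m+\mathbf n}$. The textile groupoid is the Deaconu--Renault groupoid $\mathcal{G}_T=\{(x,\mathbf m-\mathbf n,y)\in\mathsf{X}_T^+\times\mathbb{Z}^2\times\mathsf{X}_T^+\mid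 \mathbf m,\mathbf n\in\mathbb{N}^2,\ \sigma_{\mathbf m}(x)=\sigma_{\mathbf n}(y)\}$ with $(x,\mathbf a,y)(y,\mathbf b,z)=(x,\mathbf a+\mathbf b,z)$, $(x,\mathbf a,y)^{-1}=(y,-\mathbf a,x)$, unit space identified with $\mathsf{X}_T^+$, and topology with basis the sets $\{(x,\mathbf m-\mathbf n,y)\mid x\in U,\ y\in V,\ \sigma_{\mathbf m}(x)=\sigma_{\mathbf n}(y)\}$ where $U,V\subseteq\mathsf{X}_T^+$ are open and $\sigma_{\mathbf m}|_U$, $\sigma_{\mathbf n}|_V$ are homeomorphisms onto a common open set. It is an ample Hausdorff groupoid with continuous cocycle $c(x,\mathbf a,y)=\mathbf a\in\mathbb{Z}^2$. The Steinberg algebra $A_{\mathsf{k}}(\mathcal{G})$ is the $\mathsf{k}$-algebra of locally constant compactly supported functions $\mathcal{G}\to\mathsf{k}$ under convolution; for $\mathcal G_T$ its $\mathbb{Z}^2$-grading has degree-$\mathbf a$ component the functions supported on $c^{-1}(\mathbf a)$. *)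

(* Defs.v *)
From HB Require Import structures.
From mathcomp Require Import all_boot all_order all_algebra.
From mathcomp Require Import generic_quotient.
From mathcomp Require Import zify.
From mathcomp Require Import all_classical all_reals all_analysis.

Set Implicit Arguments.
Unset Strict Implicit.
Unset Printing Implicit Defensive.

Import GRing.Theory.
Local Open Scope classical_set_scope.
Local Open Scope quotient_scope.
Local Open Scope ring_scope.

Record finDigraph := FinDigraph {
  vert : finType;
  edge : finType;
  src : edge -> vert;
  rng : edge -> vert }.
Arguments src {_} _.
Arguments rng {_} _.

Definition sink_free (E : finDigraph) : Prop :=
  forall v : vert E, exists e : edge E, src e = v.

Record digraph_hom (F E : finDigraph) := DigraphHom {
  hom0 :> vert F -> vert E;
  hom1 : edge F -> edge E;
  hom_src : forall f, hom0 (src f) = src (hom1 f);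
  hom_rng : forall f, hom0 (rng f) = rng (hom1 f) }.

Definition surjective_hom (F E : finDigraph) (p : digraph_hom F E) : Prop :=
  (forall v, exists w, p w = v) /\ (forall e, exists f, hom1 p f = e).

Definition unique_r_path_lifting (F E : finDigraph) (p : digraph_hom F E) :=
  forall (v : vert F) (e : edge E), p v = rng e ->
    exists! f : edge F, rng f = v /\ hom1 p f = e.

Definition unique_s_path_lifting (F E : finDigraph) (p : digraph_hom F E) :=
  forall (v : vert F) (e : edge E), p v = src e ->
    exists! f : edge F, src f = v /\ hom1 p f = e.

Record textile_system := TextileSystem {
  tF : finDigraph;
  tE : finDigraph;
  tp : digraph_hom tF tE;
  tq : digraph_hom tF tE;
  textile_inj :
    injective (fun f : edge tF => (src f, rng f, hom1 tp f, hom1 tq f)) }.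

Definition left_resolving (T : textile_system) : Prop :=
  unique_r_path_lifting (tp T) /\ unique_s_path_lifting (tq T).

(* The associative, not necessarily unital, k-algebra presented by generators
   X and relations R: formal algebra expressions over X modulo the smallest
   congruence that contains R and the axioms of associative k-algebras. *)
Section PresentedAlgebra.
Variables (k : fieldType) (X : Type).

Inductive expr : Type :=
| EGen of X
| EZero
| EAdd of expr & expr
| EScale of k & expr
| EMul of expr & expr.

HB.instance Definition _ := gen_eqMixin expr.
HB.instance Definition _ := gen_choiceMixin expr.

Variable R : expr -> expr -> Prop.

Inductive pres_eq : expr -> expr -> Prop :=
| PRel x y : R x y -> pres_eq x y
| PRefl x : pres_eq x x
| PSym x y : pres_eq x y -> pres_eq y x
| PTrans x y z : pres_eq x y -> pres_eq y z -> pres_eq x z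
| PAdd x x' y y' :
    pres_eq x x' -> pres_eq y y' -> pres_eq (EAdd x y) (EAdd x' y')
| PScale a x x' : pres_eq x x' -> pres_eq (EScale a x) (EScale a x')
| PMul x x' y y' :
    pres_eq x x' -> pres_eq y y' -> pres_eq (EMul x y) (EMul x' y')
| PAddA x y z : pres_eq (EAdd x (EAdd y z)) (EAdd (EAdd x y) z)
| PAddC x y : pres_eq (EAdd x y) (EAdd y x)
| PAdd0 x : pres_eq (EAdd EZero x) x
| PAddN x : pres_eq (EAdd (EScale (-1) x) x) EZero
| PScaleA a b x : pres_eq (EScale a (EScale b x)) (EScale (a * b) x)
| PScale1 x : pres_eq (EScale 1 x) x
| PScaleDr a x y :
    pres_eq (EScale a (EAdd x y)) (EAdd (EScale a x) (EScale a y))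
| PScaleDl a b x :
    pres_eq (EScale (a + b) x) (EAdd (EScale a x) (EScale b x))
| PMulA x y z : pres_eq (EMul x (EMul y z)) (EMul (EMul x y) z)
| PMulDl x y z : pres_eq (EMul (EAdd x y) z) (EAdd (EMul x z) (EMul y z))
| PMulDr x y z : pres_eq (EMul x (EAdd y z)) (EAdd (EMul x y) (EMul x z))
| PMulZl a x y : pres_eq (EMul (EScale a x) y) (EScale a (EMul x y))
| PMulZr a x y : pres_eq (EMul x (EScale a y)) (EScale a (EMul x y)).

Definition pres_eqb (x y : expr) : bool := `[< pres_eq x y >].

Lemma pres_eqb_refl : reflexive pres_eqb.
Proof. by move=> x; apply/asboolP; exact: PRefl. Qed.

Lemma pres_eqb_sym : symmetric pres_eqb.
Proof. by move=> x y; apply/asboolP/asboolP => h; exact: PSym. Qed.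

Lemma pres_eqb_trans : transitive pres_eqb.
Proof.
by move=> y x z /asboolP hxy /asboolP hyz; apply/asboolP; exact: PTrans hyz.
Qed.

Canonical pres_equiv := EquivRel pres_eqb pres_eqb_refl pres_eqb_sym
  pres_eqb_trans.

Definition presented : Type := {eq_quot pres_equiv}.
HB.instance Definition _ := Choice.on presented.

Definition pcls (x : expr) : presented := \pi_({eq_quot pres_equiv}) x.
Definition prepr (x : presented) : expr := repr (x : {eq_quot pres_equiv}).

Lemma preprK : cancel prepr pcls.
Proof. by move=> x; exact: reprK. Qed.

Lemma pclsP (x y : expr) : pcls x = pcls y <-> pres_eq x y.
Proof.
by split=> [/eqmodP/asboolP//|h]; apply/eqmodP/asboolP.
Qed.

Lemma prepr_cls (x : expr) : pres_eq (prepr (pcls x)) x.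
Proof. by apply/pclsP; rewrite preprK. Qed.

Definition pgen (g : X) : presented := pcls (EGen g).
Definition pzero : presented := pcls EZero.
Definition padd (x y : presented) := pcls (EAdd (prepr x) (prepr y)).
Definition pscale (a : k) (x : presented) := pcls (EScale a (prepr x)).
Definition popp (x : presented) := pscale (-1) x.
Definition pmul (x y : presented) := pcls (EMul (prepr x) (prepr y)).

Lemma padd_cls x y : padd (pcls x) (pcls y) = pcls (EAdd x y).
Proof. by apply/pclsP/PAdd; exact: prepr_cls. Qed.

Lemma pscale_cls a x : pscale a (pcls x) = pcls (EScale a x).
Proof. by apply/pclsP/PScale; exact: prepr_cls. Qed.

Lemma pmul_cls x y : pmul (pcls x) (pcls y) = pcls (EMul x y).
Proof. by apply/pclsP/PMul; exact: prepr_cls. Qed.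

Let pE := (padd_cls, pscale_cls, pmul_cls).

Lemma paddA : associative padd.
Proof.
move=> x y z; rewrite -(preprK x) -(preprK y) -(preprK z) !pE.
by apply/pclsP; exact: PAddA.
Qed.

Lemma paddC : commutative padd.
Proof. by move=> x y; apply/pclsP; exact: PAddC. Qed.

Lemma padd0 : left_id pzero padd.
Proof. by move=> x; rewrite -(preprK x) pE; apply/pclsP; exact: PAdd0. Qed.

Lemma paddN : left_inverse pzero popp padd.
Proof. by move=> x; rewrite -(preprK x) /popp !pE; apply/pclsP/PAddN. Qed.

HB.instance Definition _ :=
  GRing.isZmodule.Build presented paddA paddC padd0 paddN.

Lemma pscaleA a b (x : presented) : pscale a (pscale b x) = pscale (a * b) x.
Proof. by rewrite -(preprK x) !pE; apply/pclsP; exact: PScaleA. Qed.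

Lemma pscale1 : left_id 1 pscale.
Proof. by move=> x; rewrite -(preprK x) pE; apply/pclsP; exact: PScale1. Qed.

Lemma pscaleDr : right_distributive pscale +%R.
Proof.
move=> a x y; rewrite -(preprK x) -(preprK y) [_ + _]pE !pE [RHS]pE.
by apply/pclsP; exact: PScaleDr.
Qed.

Lemma pscaleDl (x : presented) : {morph pscale^~ x : a b / a + b}.
Proof.
move=> a b; rewrite -(preprK x) /= !pE [RHS]pE.
by apply/pclsP; exact: PScaleDl.
Qed.

HB.instance Definition _ := GRing.Zmodule_isLmodule.Build k presented
  pscaleA pscale1 pscaleDr pscaleDl.

Lemma pmulA : associative pmul.
Proof.
move=> x y z; rewrite -(preprK x) -(preprK y) -(preprK z) !pE.
by apply/pclsP; exact: PMulA.
Qed.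

Lemma pmulDl : left_distributive pmul +%R.
Proof.
move=> x y z; rewrite -(preprK x) -(preprK y) -(preprK z) [_ + _]pE !pE [RHS]pE.
by apply/pclsP; exact: PMulDl.
Qed.

Lemma pmulDr : right_distributive pmul +%R.
Proof.
move=> x y z; rewrite -(preprK x) -(preprK y) -(preprK z) [_ + _]pE !pE [RHS]pE.
by apply/pclsP; exact: PMulDr.
Qed.

Lemma pmulZl a (x y : presented) : pmul (a *: x) y = a *: pmul x y.
Proof.
rewrite -(preprK x) -(preprK y) [_ *: _]pE !pE [RHS]pE.
by apply/pclsP; exact: PMulZl.
Qed.

Lemma pmulZr a (x y : presented) : pmul x (a *: y) = a *: pmul x y.
Proof.
rewrite -(preprK x) -(preprK y) [_ *: _]pE !pE [RHS]pE.
by apply/pclsP; exact: PMulZr.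
Qed.

Lemma pcls_rel (x y : expr) : R x y -> pcls x = pcls y.
Proof. by move=> h; apply/pclsP; exact: PRel. Qed.

(* [phomog deg a] is the degree-a component of the grading induced by a degree
   function on the generators: the span of the words of degree a. *)
Inductive phomog (D : zmodType) (deg : X -> D) : D -> presented -> Prop :=
| PHGen g : phomog deg (deg g) (pgen g)
| PHMul a b x y :
    phomog deg a x -> phomog deg b y -> phomog deg (a + b) (pmul x y)
| PH0 a : phomog deg a 0
| PHAdd a x y : phomog deg a x -> phomog deg a y -> phomog deg a (x + y)
| PHScale a c x : phomog deg a x -> phomog deg a (c *: x).

End PresentedAlgebra.

Arguments EGen {k X} _.
Arguments EZero {k X}.

Section TextileAlgebra.
Variables (k : fieldType) (T : textile_system).
Local Notation E := (tE T).
Local Notation F := (tF T).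
Local Notation p := (tp T).
Local Notation q := (tq T).

(* E^0, F^0, E^1, and the ghosts of F^0 and E^1 *)
Inductive textile_gen : Type :=
| GV of vert E
| GW of vert F
| GE of edge E
| GWs of vert F
| GEs of edge E.

Local Notation expr := (expr k textile_gen).
Local Notation V u := (EGen (GV u) : expr).
Local Notation W w := (EGen (GW w) : expr).
Local Notation Ed e := (EGen (GE e) : expr).
Local Notation Ws w := (EGen (GWs w) : expr).
Local Notation Es e := (EGen (GEs e) : expr).
Local Infix "**" := (@EMul k textile_gen) (at level 40, left associativity).

Inductive textile_rel : expr -> expr -> Prop :=
| T1 u v : textile_rel (V u ** V v) (if u == v then V u else EZero)
| T2sE e : textile_rel (V (src e) ** Ed e) (Ed e)
| T2Er e : textile_rel (Ed e ** V (rng e)) (Ed e)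
| T2rEs e : textile_rel (V (rng e) ** Es e) (Es e)
| T2Ess e : textile_rel (Es e ** V (src e)) (Es e)
| T2pW w : textile_rel (V (p w) ** W w) (W w)
| T2Wq w : textile_rel (W w ** V (q w)) (W w)
| T2qWs w : textile_rel (V (q w) ** Ws w) (Ws w)
| T2Wsp w : textile_rel (Ws w ** V (p w)) (Ws w)
| T3E e e' : textile_rel (Es e ** Ed e') (if e == e' then V (rng e) else EZero)
| T3W w w' : textile_rel (Ws w ** W w') (if w == w' then V (q w) else EZero)
| T4E u : (0 < #|[pred e : edge E | src e == u]|)%N ->
    textile_rel (V u)
      (\big[@EAdd k textile_gen/EZero]_(e : edge E | src e == u) (Ed e ** Es e))
| T4W v : (0 < #|[pred w : vert F | p w == v]|)%N ->
    textile_rel (V v)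
      (\big[@EAdd k textile_gen/EZero]_(w : vert F | p w == v) (W w ** Ws w))
| T5 f : textile_rel
    (W (src f) ** Ed (hom1 q f)) (Ed (hom1 p f) ** W (rng f))
| T5s f : textile_rel
    (Es (hom1 q f) ** Ws (src f)) (Ws (rng f) ** Es (hom1 p f)).

Definition textile_algebra := presented textile_rel.
HB.instance Definition _ := GRing.Lmodule.on textile_algebra.

Definition textile_mul : textile_algebra -> textile_algebra -> textile_algebra :=
  @pmul k textile_gen textile_rel.

Definition textile_deg (g : textile_gen) : int * int :=
  match g with
  | GV _ => (0, 0)
  | GW _ => (0, 1)
  | GE _ => (1, 0)
  | GWs _ => (0, -1)
  | GEs _ => (-1, 0)
  end.

Definition textile_homog (a : int * int) : set textile_algebra :=
  [set x | phomog textile_deg a x].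

End TextileAlgebra.

Section TextileGroupoid.
Variable T : textile_system.
Local Notation F := (tF T).

Definition quadrant_config : Type :=
  prod_topology (fun _ : nat * nat => discrete_topology (edge F)).
HB.instance Definition _ := Topological.on quadrant_config.

Definition XTset : set quadrant_config :=
  [set x | forall i j : nat,
     rng (x (i, j) : edge F) = src (x (i.+1, j) : edge F) /\
     hom1 (tq T) (x (i, j)) = hom1 (tp T) (x (i, j.+1))].

(* the library gives [set_type A] the subspace topology *)
Definition XT : Type := set_type XTset.
HB.instance Definition _ := Topological.on XT.

Definition xt (x : XT) (n : nat * nat) : edge F := set_val x n.

Lemma xtP (x : XT) : XTset (xt x).
Proof. exact: set_valP. Qed.

Lemma xt_inj (x y : XT) : xt x =1 xt y -> x = y.
Proof. by move=> h; apply/val_inj/funext. Qed.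

Definition shift_config (n : nat * nat) (x : XT) : quadrant_config :=
  fun m => xt x (m.1 + n.1, m.2 + n.2)%N.

Lemma shift_configP n x : XTset (shift_config n x).
Proof. by move=> i j; exact: xtP. Qed.

Definition shift (n : nat * nat) (x : XT) : XT :=
  SigSub (mem_set (shift_configP n x)).

Lemma shiftE n x m : xt (shift n x) m = xt x (m.1 + n.1, m.2 + n.2)%N.
Proof. by []. Qed.

Lemma shift_shift m n x :
  shift m (shift n x) = shift (m.1 + n.1, m.2 + n.2)%N x.
Proof. by apply: xt_inj => -[i j]; rewrite !shiftE /= !addnA. Qed.

Definition zsub (m n : nat * nat) : int * int :=
  (m.1%:Z - n.1%:Z, m.2%:Z - n.2%:Z).

(* The element (x, a, y) has range x and source y. *)
Record textile_groupoid := TextileArrow {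
  grng : XT;
  gdeg : int * int;
  gsrc : XT;
  textile_arrowP : exists m n : nat * nat,
    gdeg = zsub m n /\ shift m grng = shift n gsrc }.

HB.instance Definition _ := gen_eqMixin textile_groupoid.
HB.instance Definition _ := gen_choiceMixin textile_groupoid.

Lemma textile_arrow_inj (g h : textile_groupoid) :
  grng g = grng h -> gdeg g = gdeg h -> gsrc g = gsrc h -> g = h.
Proof.
case: g h => [x a y g] [x' a' y' h] /= ex ea ey.
by subst x' a' y'; rewrite (Prop_irrelevance g h).
Qed.

Lemma gmul_subproof (g h : textile_groupoid) : gsrc g = grng h ->
  exists m n : nat * nat,
    gdeg g + gdeg h = zsub m n /\ shift m (grng g) = shift n (gsrc h).
Proof.
move=> gh; have [m [n [-> Eg]]] := textile_arrowP g.
have [m' [n' [-> Eh]]] := textile_arrowP h.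
exists (m'.1 + m.1, m'.2 + m.2)%N, (n.1 + n'.1, n.2 + n'.2)%N; split.
  by congr pair => /=; lia.
rewrite -shift_shift Eg gh shift_shift -[RHS]shift_shift -Eh shift_shift.
by rewrite addnC [(m'.2 + _)%N]addnC.
Qed.

Definition gmul (g h : textile_groupoid) (gh : gsrc g = grng h) :
  textile_groupoid := TextileArrow (gmul_subproof gh).

Lemma ginv_subproof (g : textile_groupoid) : exists m n : nat * nat,
  - gdeg g = zsub m n /\ shift m (gsrc g) = shift n (grng g).
Proof.
have [m [n [-> Eg]]] := textile_arrowP g; exists n, m; split=> //.
by congr pair; rewrite opprB.
Qed.

Definition ginv (g : textile_groupoid) : textile_groupoid :=
  TextileArrow (ginv_subproof g).

Definition restricts_to_homeo (A B : topologicalType) (f : A -> B)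
    (U : set A) (W : set B) : Prop :=
  {within U, continuous f} /\
  exists g : B -> A, [/\ {within W, continuous g},
    f @` U `<=` W, g @` W `<=` U,
    (forall x, U x -> g (f x) = x) & (forall y, W y -> f (g y) = y)].

Definition textile_basic_set (m n : nat * nat) (U V : set XT) :
    set textile_groupoid :=
  [set g | [/\ U (grng g), V (gsrc g), gdeg g = zsub m n
             & shift m (grng g) = shift n (gsrc g)]].

Definition textile_basis : set (set textile_groupoid) :=
  [set Z | exists m n (U V W : set XT),
    [/\ [/\ open U, open V & open W],
        restricts_to_homeo (shift m) U W,
        restricts_to_homeo (shift n) V W
      & Z = textile_basic_set m n U V]].

(* The topology generated by [textile_basis], which is a basis of it when the
   shifts are local homeomorphisms. *)
HB.instance Definition _ :=
  isSubBaseTopological.Build textile_groupoid textile_basis id.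

End TextileGroupoid.

Section Steinberg.
Variables (k : fieldType) (T : textile_system).
Local Notation G := (textile_groupoid T).

Definition locally_constant (S : topologicalType) (f : S -> k) : Prop :=
  forall x, \forall y \near x, f y = f x.

Definition compactly_supported (S : topologicalType) (f : S -> k) : Prop :=
  compact (closure [set x | f x != 0]).

(* [k^o] is k seen as a module over itself, so that [G -> k^o] is the k-module
   of all functions with pointwise operations. *)
Definition steinberg_algebra : set (G -> k^o) :=
  [set f | locally_constant f /\ compactly_supported f].

(* A sum with infinitely many nonzero terms would be 0 by convention; this does
   not occur for f, h in [steinberg_algebra]. *)
Definition convolution (f h : G -> k^o) : G -> k^o := fun g =>
  \sum_(ab \in [set ab : G * G |
         exists c : gsrc ab.1 = grng ab.2, gmul c = g]) (f ab.1 * h ab.2 : k).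

Definition steinberg_homog (a : int * int) : set (G -> k^o) :=
  [set f | steinberg_algebra f /\ (forall g, f g != 0 -> gdeg g = a)].

End Steinberg.

Arguments textile_homog : clear implicits.
Arguments steinberg_algebra : clear implicits.
Arguments steinberg_homog : clear implicits.

(* Main.v *)
From HB Require Import structures.
Require Import Defs.
From mathcomp Require Import all_boot all_order all_algebra.
From mathcomp Require Import finmap.
From mathcomp Require Import all_classical all_reals all_analysis.
From mathcomp Require Import zify.

(* A left-resolving textile system is a 2-graph: edges of E are the paths of
   degree (1,0), vertices of F the paths of degree (0,1), and edges of F are the
   commuting squares, factored uniquely in both ways. Let A(T) act on functions
   of pairs (x, a), with x an infinite path and a in Z^2, by prepending and
   removing the first letter of x; since every element acts by finite sums over
   arrows, applying z to the delta function at (y, 0) gives a function of the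
   arrows (x, a, y), and this turns products into convolutions.
     Each homogeneous component of A(T) is the union of the spans D(m, n) of the
   elements mu nu^* with mu of degree m, nu of degree n and m - n fixed, which
   increase with (m, n). An element of D(m, n) can be recovered from its products
   with ghosts on the left and letters on the right, which lie in smaller spans,
   down to a combination of vertices; as every vertex starts an infinite path,
   the map is injective. The image of D(m, n) consists of the functions on
   {(x, m - n, y) | sigma_m x = sigma_n y} which depend only on the initial
   segments of degree m of x and n of y. These sets of arrows are compact and
   open, so by compactness of supports every element of the Steinberg algebra is a
   finite sum of such functions. *)

Set Implicit Arguments.
Unset Strict Implicit.
Unset Printing Implicit Defensive.

Import GRing.Theory.
Local Open Scope classical_set_scope.
Local Open Scope ring_scope.

Local Notation shift := Defs.shift.

(** * Infinite paths *)

(** Directions are booleans: [false] is e_1, the direction of the edges of E, and [true] is e_2,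
    that of the vertices of F. *)
Definition degS (d : bool) (m : nat * nat) : nat * nat :=
  if d then (m.1, m.2.+1) else (m.1.+1, m.2).

Definition unit_vec (d : bool) : int * int := if d then (0, 1) else (1, 0).

Lemma degS_swap d d' m : degS d (degS d' m) = degS d' (degS d m).
Proof. by case: d d' => [] []. Qed.

Lemma degS_inj d : injective (degS d).
Proof. by case: d => -[a b] [a' b'] [-> ->]. Qed.

Lemma degS_neq_inv d d' m m' : d != d' -> degS d m = degS d' m' ->
  exists m0, m = degS d' m0 /\ m' = degS d m0.
Proof.
case: d d' m m' => [] [] // [a b] [a' b'] _ [].
  by move=> -> <-; exists (a', b).
by move=> <- ->; exists (a, b').
Qed.

Lemma deg_ind (P : nat * nat -> Prop) :
  P (0, 0)%N -> (forall d m, P m -> P (degS d m)) -> forall m, P m.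
Proof.
move=> P0 PS [a b]; elim: a => [|a IH]; last exact: (PS false (a, b)).
by elim: b => [//|b IH]; exact: (PS true (0, b)%N).
Qed.

Lemma degSN0 d m : degS d m <> (0, 0)%N.
Proof. by case: d. Qed.

Lemma zsub_degSl d m n : zsub (degS d m) n = zsub m n + unit_vec d.
Proof. by case: d; congr pair => /=; lia. Qed.

Lemma zsub_degSr d m n : zsub m (degS d n) = zsub m n - unit_vec d.
Proof. by case: d; congr pair => /=; lia. Qed.

Lemma zsubnn m : zsub m m = 0.
Proof. by rewrite /zsub !subrr. Qed.

Section Paths.
Variable T : textile_system.
Local Notation E := (tE T).
Local Notation F := (tF T).
Local Notation p := (tp T).
Local Notation q := (tq T).
Local Notation X := (XT T).

(** The paths of degree (1,0) and (0,1) of the 2-graph. A vertex [w] of F runs from [p w] to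
    [q w]. *)
Definition letter : finType := (edge E + vert F)%type.

Definition dir (l : letter) : bool := if l is inr _ then true else false.
Definition lsrc (l : letter) : vert E :=
  match l with inl e => src e | inr w => p w end.
Definition lrng (l : letter) : vert E :=
  match l with inl e => rng e | inr w => q w end.

(** A square is pictured with bottom [p], top [q], left side [src] and right side [rng]; [base] is
    the lower left corner of the square at the origin. *)
Definition base (x : X) : vert E := src (hom1 p (xt x (0, 0)%N)).
Definition hd (d : bool) (x : X) : letter :=
  if d then inr (src (xt x (0, 0)%N)) else inl (hom1 p (xt x (0, 0)%N)).
Definition tl (d : bool) (x : X) : X := shift (degS d (0, 0)%N) x.

Lemma xt_rng (x : X) i j : rng (xt x (i, j)) = src (xt x (i.+1, j)).
Proof. exact: (xtP x i j).1. Qed.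

Lemma xt_q (x : X) i j : hom1 q (xt x (i, j)) = hom1 p (xt x (i, j.+1)).
Proof. exact: (xtP x i j).2. Qed.

Lemma dir_hd d x : dir (hd d x) = d.
Proof. by case: d. Qed.

Lemma lsrc_hd d x : lsrc (hd d x) = base x.
Proof. by case: d => //=; rewrite hom_src. Qed.

Lemma lrng_hd d x : lrng (hd d x) = base (tl d x).
Proof.
case: d => /=; rewrite /base shiftE /= ?add0n.
  by rewrite hom_src -xt_q.
by rewrite -hom_rng xt_rng hom_src.
Qed.

Lemma xt_tl d x i j : xt (tl d x) (i, j) = xt x (degS d (i, j)).
Proof. by rewrite shiftE; case: d; rewrite /= addn0 addn1. Qed.

Lemma shift_deg0 (x : X) : shift (0, 0)%N x = x.
Proof. by apply: xt_inj => -[i j]; rewrite shiftE /= !addn0. Qed.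

Lemma shift_degS d m (x : X) : shift (degS d m) x = shift m (tl d x).
Proof. by rewrite shift_shift; case: d; rewrite /= addn0 addn1; case: m. Qed.

Lemma tl_shift d m (x : X) : tl d (shift m x) = shift m (tl d x).
Proof. by rewrite /tl !shift_shift; congr (shift (_, _) x); rewrite addnC. Qed.

(** * Unique removal and prepending of letters *)

Hypothesis hT : left_resolving T.

(** Unique r-path lifting: right side and bottom fix a square. Unique s-path lifting gives the same
    below for left side and top. *)
Lemma square_rp_inj (f g : edge F) : rng f = rng g -> hom1 p f = hom1 p g -> f = g.
Proof.
move=> e1 e2; have [h [_ hU]] := hT.1 (rng f) (hom1 p f) (hom_rng p f).
by rewrite -(hU f) // -(hU g).
Qed.

Lemma square_sq_inj (f g : edge F) : src f = src g -> hom1 q f = hom1 q g -> f = g.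
Proof.
move=> e1 e2; have [h [_ hU]] := hT.2 (src f) (hom1 q f) (hom_src q f).
by rewrite -(hU f) // -(hU g).
Qed.

(** The tail is all of [x] except one boundary row or column, which is rebuilt square by square: a
    row rightwards by left side and top, a column upwards by right side and bottom. *)
Lemma hd_tl_inj d x y : hd d x = hd d y -> tl d x = tl d y -> x = y.
Proof.
move=> eh et; apply: xt_inj; have exy i j : xt x (degS d (i, j)) = xt y (degS d (i, j)).
  by rewrite -!xt_tl et.
case: d eh exy {et} => /= -[eh] exy [i j].
  case: j => [|j]; last exact: exy.
  elim: i => [|i IH].
    by apply: square_sq_inj => //; rewrite !xt_q exy.
  by apply: square_sq_inj; [rewrite -!xt_rng IH | rewrite !xt_q exy].
case: i => [|i]; last exact: exy.
elim: j => [|j IH].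
  by apply: square_rp_inj => //; rewrite !xt_rng exy.
by apply: square_rp_inj; [rewrite !xt_rng exy | rewrite -!xt_q IH].
Qed.

Lemma mk_XT (c : nat * nat -> edge F) :
  (forall i j, rng (c (i, j)) = src (c (i.+1, j)) /\
     hom1 q (c (i, j)) = hom1 p (c (i, j.+1))) ->
  exists x : X, xt x = c.
Proof.
by move=> hc; exists (SigSub (mem_set (hc : @XTset T c))).
Qed.

(** A new column is built upwards by r-path lifting, each square resting on the top of the previous
    one and touching [x] on its right; a new row is built rightwards by s-path lifting. *)
Lemma cons_exists l x : lrng l = base x ->
  exists y, hd (dir l) y = l /\ tl (dir l) y = x.
Proof.
case: l => [e|w] /= hx.
  (* Lifting is made total, so that it can be iterated; the square of [x] at the origin is a default
     for pairs that do not match. *)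
  have /choice[lift liftP] : forall we : vert F * edge E, exists f,
      p we.1 = rng we.2 -> rng f = we.1 /\ hom1 p f = we.2.
    move=> [w' e'] /=; have [h|h] := pselect (p w' = rng e').
      by have [f [hf _]] := hT.1 _ _ h; exists f.
    by exists (xt x (0, 0)%N) => /h.
  pose c := fix c j := if j is j'.+1 then lift (src (xt x (0, j)%N), hom1 q (c j'))
    else lift (src (xt x (0, 0)%N), e).
  have cP j : rng (c j) = src (xt x (0, j)%N).
    elim: j => [|j IH] /=; apply: (liftP (_, _) _).1 => /=.
      by rewrite hx hom_src.
    by rewrite -hom_rng IH !hom_src -xt_q -hom_src.
  have c0 : hom1 p (c 0%N) = e.
    by apply: (liftP (_, _) _).2 => /=; rewrite hx hom_src.
  have cS j : hom1 p (c j.+1) = hom1 q (c j).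
    by apply: (liftP (_, _) _).2 => /=; rewrite -hom_rng cP !hom_src -xt_q -hom_src.
  have [|y yE] := @mk_XT (fun ij => if ij.1 is i.+1 then xt x (i, ij.2) else c ij.2).
    by case=> [|i] j /=; rewrite ?cP ?cS ?xt_rng ?xt_q.
  exists y; split; first by rewrite /hd yE /= c0.
  by apply: xt_inj => -[i j]; rewrite xt_tl yE.
have /choice[lift liftP] : forall we : vert F * edge E, exists f,
    q we.1 = src we.2 -> src f = we.1 /\ hom1 q f = we.2.
  move=> [w' e'] /=; have [h|h] := pselect (q w' = src e').
    by have [f [hf _]] := hT.2 _ _ h; exists f.
  by exists (xt x (0, 0)%N) => /h.
pose c := fix c j := if j is j'.+1 then lift (rng (c j'), hom1 p (xt x (j, 0)%N))
  else lift (w, hom1 p (xt x (0, 0)%N)).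
have cP j : hom1 q (c j) = hom1 p (xt x (j, 0)%N).
  elim: j => [|j IH] /=; apply: (liftP (_, _) _).2 => //=.
  by rewrite hom_rng IH -hom_src -xt_rng hom_rng.
have c0 : src (c 0%N) = w by apply: (liftP (_, _) _).1.
have cS j : src (c j.+1) = rng (c j).
  by apply: (liftP (_, _) _).1 => /=; rewrite hom_rng cP -hom_src -xt_rng hom_rng.
have [|y yE] := @mk_XT (fun ij => if ij.2 is j.+1 then xt x (ij.1, j) else c ij.1).
  by move=> i [|j] /=; rewrite ?cP ?cS ?xt_rng ?xt_q.
exists y; split; first by rewrite /hd yE /= c0.
by apply: xt_inj => -[i j]; rewrite xt_tl yE.
Qed.

(* [cons l x] is [x] when [l] cannot be prepended to [x]. *)
Definition cons (l : letter) (x : X) : X :=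
  if pselect (exists y, hd (dir l) y = l /\ tl (dir l) y = x) is left h
  then projT1 (cid h) else x.

Lemma consP l x : lrng l = base x ->
  hd (dir l) (cons l x) = l /\ tl (dir l) (cons l x) = x.
Proof.
move=> h; rewrite /cons; case: pselect => [h'|[]]; last exact: cons_exists.
exact: (projT2 (cid h')).
Qed.

Lemma base_cons l x : lrng l = base x -> base (cons l x) = lsrc l.
Proof. by move=> h; rewrite -(lsrc_hd (dir l)) (consP h).1. Qed.

Lemma cons_hd_tl d x : cons (hd d x) (tl d x) = x.
Proof.
have h := lrng_hd d x.
by apply: (@hd_tl_inj d); have := consP h; rewrite dir_hd => -[].
Qed.

(** This is (T5) on points. The square of the right hand side at the origin is [f], so reading that
    point in the other order gives the letters [src f] and [hom1 q f]. *)
Lemma cons_square (f : edge F) x : rng (hom1 q f) = base x ->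
  cons (inr (src f)) (cons (inl (hom1 q f)) x) =
  cons (inl (hom1 p f)) (cons (inr (rng f)) x).
Proof.
move=> hx; have h1 : lrng (inr (rng f)) = base x by rewrite /= hom_rng.
have h2 : lrng (inl (hom1 p f)) = base (cons (inr (rng f)) x).
  by rewrite base_cons //= hom_rng.
set y := RHS; have [/= hy ty] := consP h2; have [/= [hz] tz] := consP h1.
have y00 : xt y (0, 0)%N = f.
  by case: hy => hy; apply: square_rp_inj => //; rewrite xt_rng -(xt_tl false) ty.
rewrite -[RHS](cons_hd_tl true); congr cons; first by rewrite /= y00.
rewrite -[RHS](cons_hd_tl false); congr cons.
  by rewrite /= xt_tl /= -xt_q y00.
rewrite -[LHS]tz -[in LHS]ty; exact: (tl_shift true (degS false (0, 0)%N) y).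
Qed.

(** Equality of the initial paths of degree [m], tested on the unit segments of the rectangle with
    corners (0,0) and [m]. The clause on [base] carries the content when [m] is (0,0). *)
Definition eqbox (m : nat * nat) (x y : X) : Prop :=
  [/\ forall i j, (i < m.1)%N -> (j <= m.2)%N ->
        hom1 p (xt x (i, j)) = hom1 p (xt y (i, j)),
      forall i j, (i <= m.1)%N -> (j < m.2)%N ->
        src (xt x (i, j)) = src (xt y (i, j))
    & base x = base y].

Definition agree (K : nat) (x y : X) : Prop :=
  forall i j, (i < K)%N -> (j < K)%N -> xt x (i, j) = xt y (i, j).

Lemma agree_eqbox K m x y : (m.1 < K)%N -> (m.2 < K)%N ->
  agree K x y -> eqbox m x y.
Proof.
move=> h1 h2 h; split=> [i j ? ?|i j ? ?|]; rewrite ?/base h //; lia.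
Qed.

Lemma eqbox_agree m K x y : (K <= m.1)%N -> (K <= m.2)%N ->
  eqbox m x y -> agree K x y.
Proof.
move=> h1 h2 [hp hs _] i j hi hj; apply: square_rp_inj; last by apply: hp; lia.
by rewrite !xt_rng hs //; lia.
Qed.

Lemma eqbox0 x y : eqbox (0, 0)%N x y <-> base x = base y.
Proof. by split=> [[]//|h]; split. Qed.

(** Unique factorization of the initial path. From right to left, the segments missing from the tail
    lie along the first row or column and are obtained one after the other from the first letter, as
    in [hd_tl_inj]. *)
Lemma eqbox_degS d m x y : eqbox (degS d m) x y <->
  hd d x = hd d y /\ eqbox m (tl d x) (tl d y).
Proof.
case: m => a b; split=> [[hp hs hb]|[eh [hp hs _]]].
  have eh : hd d x = hd d y.
    by case: d hp hs => hp hs /=; rewrite ?hp // hs.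
  split=> //; split; last by rewrite -!lrng_hd eh.
    by move=> i j ? ?; rewrite !xt_tl; case: (d) hp => hp; apply: hp.
  by move=> i j ? ?; rewrite !xt_tl; case: (d) hs => hs; apply: hs.
have eb : base x = base y by rewrite -!(lsrc_hd d) eh.
case: d eh hp hs => /= eh hp hs; split=> // i j /=.
- case: j => [|j] hi hj; last by have := hp i j hi hj; rewrite !xt_tl.
  case: eh => eh; congr (hom1 p _); elim: i hi => [|i IH] hi.
    apply: square_sq_inj => //; rewrite !xt_q.
    by have := hp 0%N 0%N; rewrite !xt_tl; apply.
  apply: square_sq_inj; first by rewrite -!xt_rng IH // ltnW.
  by rewrite !xt_q; have := hp i.+1 0%N; rewrite !xt_tl; apply.
- case: j => [|j] hi hj; last by have := hs i j hi hj; rewrite !xt_tl.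
  case: eh => eh; elim: i hi => [//|i IH] hi; rewrite -!xt_rng; congr rng.
  apply: square_sq_inj; first by apply: IH; exact: ltnW.
  by rewrite !xt_q; have := hp i 0%N; rewrite !xt_tl; apply.
- case: i => [|i] hi hj; last by have := hp i j hi hj; rewrite !xt_tl.
  case: eh => eh; elim: j hj => [//|j IH] hj; rewrite -!xt_q; congr (hom1 q _).
  apply: square_rp_inj; last by apply: IH; exact: ltnW.
  by rewrite !xt_rng; have := hs 0%N j; rewrite !xt_tl; apply.
- case: i => [|i] hi hj; last by have := hs i j hi hj; rewrite !xt_tl.
  case: eh => eh; congr src; elim: j hj => [|j IH] hj.
    apply: square_rp_inj => //; rewrite !xt_rng.
    by have := hs 0%N 0%N; rewrite !xt_tl; apply.
  apply: square_rp_inj; last by rewrite -!xt_q IH // ltnW.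
  by rewrite !xt_rng; have := hs 0%N j.+1; rewrite !xt_tl; apply.
Qed.

Lemma eqbox_shift_inj m x y : eqbox m x y -> shift m x = shift m y -> x = y.
Proof.
elim/deg_ind: m x y => [|d m IH] x y; first by rewrite !shift_deg0.
rewrite eqbox_degS !shift_degS => -[eh em] es.
by apply: (hd_tl_inj eh); exact: IH.
Qed.

(** * Every vertex starts an infinite path *)

Section Existence.
Hypotheses (hE : sink_free E) (hp : surjective_hom p).

Definition row_from (eta : nat -> edge E) (w : vert F) (n : nat) : Prop :=
  exists f : nat -> edge F, src (f 0%N) = w /\
    (forall i, (i < n)%N -> hom1 p (f i) = eta i /\ rng (f i) = src (f i.+1)).

(** Finite rows are built from right to left: surjectivity of [p] supplies the last square and
    r-path lifting each preceding one. An infinite row has no right end to start from, hence the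
    compactness argument that follows. *)
Lemma row_back (eta : nat -> edge E) n :
  (forall i, rng (eta i) = src (eta i.+1)) ->
  exists w, p w = src (eta 0%N) /\ row_from eta w n.
Proof.
elim: n eta => [|n IH] eta he.
  have [f hf] := hp.2 (eta 0%N).
  exists (src f); split; first by rewrite hom_src hf.
  by exists (fun=> f); split.
have [w [hw [f [f0 fP]]]] := IH (fun i => eta i.+1) (fun i => he i.+1).
have [g [[g1 g2] _]] := hT.1 w (eta 0%N) (etrans hw (esym (he 0%N))).
exists (src g); split; first by rewrite hom_src g2.
exists (fun i => if i is i'.+1 then f i' else g); split=> // -[|i] hi.
  by rewrite g1 f0.
exact: fP.
Qed.

(* Koenig's lemma. *)
Lemma row_exists (eta : nat -> edge E) :
  (forall i, rng (eta i) = src (eta i.+1)) ->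
  exists f : nat -> edge F, forall i, hom1 p (f i) = eta i /\ rng (f i) = src (f i.+1).
Proof.
(* [good i w]: rows of every finite length start at [w] over the tail of [eta] from [i]. *)
move=> he; pose good i w := forall n, row_from (fun j => eta (i + j)%N) w n.
have row_le i w m n : (m <= n)%N ->
    row_from (fun j => eta (i + j)%N) w n -> row_from (fun j => eta (i + j)%N) w m.
  by move=> hmn [f [f0 fP]]; exists f; split=> // j hj; apply: fP; apply: leq_trans hmn.
have pick (S : finType) i (P : S -> Prop) (W : S -> vert F) :
    (forall n, exists2 s, P s & row_from (fun j => eta (i + j)%N) (W s) n) ->
    exists2 s, P s & good i (W s).
  (* Otherwise each [s] fails at some length [N s], and a row as long as the maximum of these
     truncates to one that cannot exist. *)
  move=> h; apply: contrapT => hn.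
  have /choice[N NP] : forall s, exists n, P s ->
      ~ row_from (fun j => eta (i + j)%N) (W s) n.
    move=> s; have [hs|hs] := pselect (P s); last by exists 0%N.
    have : ~ good i (W s) by move=> hg; apply: hn; exists s.
    by move=> /existsNP[n hn']; exists n.
  have [s hs hr] := h (\max_s N s).
  by apply: (NP s hs); apply: row_le hr; exact: leq_bigmax.
have [w0 _ g0] : exists2 w : vert F, True & good 0%N w.
  apply: (pick _ _ (fun=> True) id) => n.
  by have [w [_ hw]] := row_back n he; exists w.
have step i w : good i w -> exists2 f, src f = w /\ hom1 p f = eta i & good i.+1 (rng f).
  move=> hg; apply: (pick _ _ (fun f => src f = w /\ hom1 p f = eta i)) => n.
  have [f [f0 fP]] := hg n.+1; have [fp fr] := fP 0%N isT.
  exists (f 0%N); first by rewrite fp addn0.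
  exists (fun j => f j.+1); split; first by rewrite fr.
  by move=> j hj; rewrite addSnnS; exact: fP.
have /choice[nx nxP] : forall iw : nat * vert F, exists f, good iw.1 iw.2 ->
    [/\ src f = iw.2, hom1 p f = eta iw.1 & good iw.1.+1 (rng f)].
  move=> [i w] /=; have [hg|hg] := pselect (good i w).
    by have [f [? ?] ?] := step _ _ hg; exists f.
  by have [f _] := hp.2 (eta 0%N); exists f => /hg.
pose W := fix W i := if i is i'.+1 then rng (nx (i', W i')) else w0.
have gW i : good i (W i).
  by elim: i => [//|i IH] /=; have [] := nxP (i, W i) IH.
exists (fun i => nx (i, W i)) => i; have [_ -> _] := nxP (i, W i) (gW i).
by split=> //; have [-> _ _] := nxP (i.+1, W i.+1) (gW i.+1).
Qed.

(** Sink-freeness gives an infinite path of E starting at [u]; [row_exists] puts a row of squares on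
    it, then a row on the top sides of that one, and so on. *)
Lemma base_surj u : exists x, base x = u.
Proof.
have /choice[nx nxP] := hE.
pose eta := fix eta i := if i is i'.+1 then nx (rng (eta i')) else nx u.
have etaP i : rng (eta i) = src (eta i.+1) by rewrite /= nxP.
have /choice[row rowP] : forall eta : nat -> edge E, exists f : nat -> edge F,
    (forall i, rng (eta i) = src (eta i.+1)) ->
    forall i, hom1 p (f i) = eta i /\ rng (f i) = src (f i.+1).
  move=> eta'; have [h|h] := pselect (forall i, rng (eta' i) = src (eta' i.+1)).
    by have [f hf] := row_exists h; exists f.
  by have [f _] := hp.2 (eta' 0%N); exists (fun=> f) => /h.
pose R := fix R j := if j is j'.+1 then row (fun i => hom1 q (R j' i)) else row eta.
have RP j : (forall i, rng (R j i) = src (R j i.+1)) /\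
    (forall i, hom1 p (R j i) = if j is j'.+1 then hom1 q (R j' i) else eta i).
  elim: j => [|j [IH _]] /=.
    by split=> i; have [] := rowP _ etaP i.
  have hq i : rng (hom1 q (R j i)) = src (hom1 q (R j i.+1)).
    by rewrite -hom_rng IH hom_src.
  by split=> i; have [] := rowP _ hq i.
have [|x xE] := @mk_XT (fun ij => R ij.2 ij.1).
  by move=> i j /=; split; [exact: (RP j).1 | rewrite (RP j.+1).2].
by exists x; rewrite /base xE /= (RP 0%N).2 /= nxP.
Qed.

End Existence.
End Paths.

(** * The representation on functions of infinite paths *)

Section Representation.
Variables (k : fieldType) (T : textile_system).
Local Notation E := (tE T).
Local Notation F := (tF T).
Local Notation p := (tp T).
Local Notation q := (tq T).
Local Notation X := (XT T).
Local Notation M := (X -> int * int -> k).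
Local Notation expr := (expr k (textile_gen T)).

Hypothesis hT : left_resolving T.

Definition op_vert (u : vert E) (psi : M) : M :=
  fun x a => if u == base x then psi x a else 0.
(** On delta functions, a letter [l] sends the one at (y, b) to the one at (l y, b + e) with e the
    degree of [l], and its ghost reverses this; both give 0 when [l] does not fit. *)
Definition op_letter (l : letter T) (psi : M) : M :=
  fun x a => if hd (dir l) x == l
    then psi (tl (dir l) x) (a - unit_vec (dir l)) else 0.
Definition op_ghost (l : letter T) (psi : M) : M :=
  fun x a => if lrng l == base x
    then psi (cons l x) (a + unit_vec (dir l)) else 0.

Fixpoint rep (x : expr) (psi : M) : M :=
  match x with
  | EGen (GV u) => op_vert u psi
  | EGen (GW w) => op_letter (inr w) psi
  | EGen (GE e) => op_letter (inl e) psi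
  | EGen (GWs w) => op_ghost (inr w) psi
  | EGen (GEs e) => op_ghost (inl e) psi
  | EZero => fun _ _ => 0
  | EAdd y z => fun v a => rep y psi v a + rep z psi v a
  | EScale c y => fun v a => c * rep y psi v a
  | EMul y z => rep y (rep z psi)
  end.

Definition arrow_from (x0 : X) (b : int * int) (z : X) : Prop :=
  exists m n, b = zsub m n /\ shift m x0 = shift n z.

Lemma arrow_from_trans x y z a b :
  arrow_from x a y -> arrow_from y b z -> arrow_from x (a + b) z.
Proof.
move=> h1 h2.
exact: (@gmul_subproof T (TextileArrow h1) (TextileArrow h2) erefl).
Qed.

Lemma arrow_from_refl x : arrow_from x 0 x.
Proof. by exists (0, 0)%N, (0, 0)%N; split. Qed.

Lemma arrow_from_tl d x : arrow_from x (unit_vec d) (tl d x).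
Proof.
exists (degS d (0, 0)%N), (0, 0)%N; rewrite shift_degS; split=> //.
by rewrite zsub_degSl zsubnn add0r.
Qed.

Lemma arrow_from_cons l x : lrng l = base x ->
  arrow_from x (- unit_vec (dir l)) (cons l x).
Proof.
move=> h; exists (0, 0)%N, (degS (dir l) (0, 0)%N).
by rewrite shift_degS (consP hT h).2 zsub_degSr zsubnn add0r.
Qed.

(** The row at [x0] of the matrix of [R]: finitely many entries, all at arrows with range [x0], and
    invariant under translation of the degree. *)
Definition has_kernel (R : M -> M) (x0 : X) : Prop :=
  exists s : seq (k * ((int * int) * X)),
    (forall i, i \in s -> arrow_from x0 i.2.1 i.2.2) /\
    forall psi a, R psi x0 a = \sum_(i <- s) i.1 * psi i.2.2 (a - i.2.1).

Lemma has_kernel0 R x0 : (forall psi a, R psi x0 a = 0) -> has_kernel R x0.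
Proof. by move=> hR; exists [::]; split=> // psi a; rewrite big_nil. Qed.

Lemma has_kernel1 R x0 b z : arrow_from x0 b z ->
  (forall psi a, R psi x0 a = psi z (a - b)) -> has_kernel R x0.
Proof.
move=> hb hR; exists [:: (1, (b, z))]; split.
  by move=> i; rewrite inE => /eqP ->.
by move=> psi a; rewrite big_seq1 hR mul1r.
Qed.

Lemma op_letter_kernel l x0 : has_kernel (op_letter l) x0.
Proof.
have [e|e] := boolP (hd (dir l) x0 == l).
  by apply: (has_kernel1 (arrow_from_tl (dir l) x0)) => psi a; rewrite /op_letter e.
by apply: has_kernel0 => psi a; rewrite /op_letter (negPf e).
Qed.

Lemma op_ghost_kernel l x0 : has_kernel (op_ghost l) x0.
Proof.
have [e|e] := boolP (lrng l == base x0).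
  apply: (has_kernel1 (arrow_from_cons (eqP e))) => psi a.
  by rewrite /op_ghost e opprK.
by apply: has_kernel0 => psi a; rewrite /op_ghost (negPf e).
Qed.

(** For a product the arrows are composed. Linearity, translation invariance, supports and the
    convolution formula are all read off from this finite list. *)
Lemma rep_kernel (x : expr) (x0 : X) : has_kernel (rep x) x0.
Proof.
elim: x x0 => [[u|w|e|w|e]||y IHy z IHz|c y IHy|y IHy z IHz] x0 //=;
  try exact: op_letter_kernel; try exact: op_ghost_kernel.
- have [e|e] := boolP (u == base x0).
    apply: (has_kernel1 (arrow_from_refl x0)) => psi a.
    by rewrite /op_vert e subr0.
  by apply: has_kernel0 => psi a; rewrite /op_vert (negPf e).
- exact: has_kernel0.
- have [s [hs sE]] := IHy x0; have [t [ht tE]] := IHz x0.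
  exists (s ++ t); split; last by move=> psi a; rewrite sE tE big_cat.
  by move=> i; rewrite mem_cat => /orP[/hs|/ht].
- have [s [hs sE]] := IHy x0.
  exists [seq (c * i.1, i.2) | i <- s]; split; first by move=> i /mapP[j /hs ? ->].
  move=> psi a; rewrite sE big_map mulr_sumr.
  by apply: eq_bigr => i _; rewrite mulrA.
- have [s [hs sE]] := IHy x0.
  have /choice[t tP] := IHz.
  exists [seq (i.1 * j.1, (i.2.1 + j.2.1, j.2.2)) | i <- s, j <- t i.2.2]; split.
    move=> _ /allpairsPdep[i [j [hi hj ->]]] /=.
    by apply: arrow_from_trans (hs _ hi) _; exact: (tP _).1.
  move=> psi a; rewrite sE big_allpairs_dep; apply: eq_bigr => i _ /=.
  rewrite (tP i.2.2).2 mulr_sumr; apply: eq_bigr => j _ /=.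
  by rewrite mulrA opprD addrA.
Qed.

Lemma rep_add x (psi psi' : M) :
  rep x (fun v a => psi v a + psi' v a) = fun v a => rep x psi v a + rep x psi' v a.
Proof.
apply/funext => v; apply/funext => a; have [s [_ sE]] := rep_kernel x v.
by rewrite !sE -big_split /=; apply: eq_bigr => i _; rewrite mulrDr.
Qed.

Lemma rep_scale x c (psi : M) :
  rep x (fun v a => c * psi v a) = fun v a => c * rep x psi v a.
Proof.
apply/funext => v; apply/funext => a; have [s [_ sE]] := rep_kernel x v.
by rewrite !sE mulr_sumr; apply: eq_bigr => i _; rewrite mulrCA.
Qed.

Lemma rep_translate x b (psi : M) :
  rep x (fun v a => psi v (a + b)) = fun v a => rep x psi v (a + b).
Proof.
apply/funext => v; apply/funext => a; have [s [_ sE]] := rep_kernel x v.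
by rewrite !sE; apply: eq_bigr => i _; rewrite addrAC.
Qed.

Lemma rep_big (I : finType) (P : pred I) (f : I -> expr) psi x a :
  rep (\big[@EAdd k _/EZero]_(i | P i) f i) psi x a = \sum_(i | P i) rep (f i) psi x a.
Proof. by elim/big_rec2: _ => [//|i y1 y2 _ <-]. Qed.

Lemma op_ghost_letter l l' psi : dir l = dir l' ->
  op_ghost l (op_letter l' psi) =
  if l == l' then op_vert (lrng l) psi else fun _ _ => 0.
Proof.
move=> hd; apply/funext => x; apply/funext => a; rewrite /op_ghost /op_letter.
case: eqP => [h|h]; last by case: ifP => // _; rewrite /op_vert; case: eqP.
rewrite -hd (consP hT h).1 (consP hT h).2; case: ifP => //.
by rewrite /op_vert h eqxx addrK.
Qed.

Lemma op_letter_ghost l psi : op_letter l (op_ghost l psi) =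
  fun x a => if hd (dir l) x == l then psi x a else 0.
Proof.
apply/funext => x; apply/funext => a; rewrite /op_ghost /op_letter.
by case: eqP => // h; rewrite -{1}h lrng_hd eqxx -{1}h (cons_hd_tl hT) subrK.
Qed.

(** The content of (T4): a path has exactly one first letter in each direction, so the projections
    onto the paths starting with [l] add up to the one onto the paths based at [u]. *)
Lemma sum_hd d u (psi : M) x a :
  \sum_(l : letter T | (dir l == d) && (lsrc l == u))
    (if hd d x == l then psi x a else 0) = op_vert u psi x a.
Proof.
rewrite -big_mkcondr /= /op_vert.
rewrite (eq_bigl (fun l => (l == hd d x) && (u == base x))).
  case: eqP => _; last by rewrite big_pred0 // => l; rewrite andbF.
  by rewrite (eq_bigl (pred1 (hd d x))) ?big_pred1_eq // => l; rewrite andbT.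
move=> l; rewrite [hd d x == l]eq_sym andbC; case: eqP => //= ->.
by rewrite dir_hd lsrc_hd eqxx eq_sym.
Qed.

Lemma sum_letter_split (V : nmodType) d u (f : letter T -> V) :
  \sum_(l : letter T | (dir l == d) && (lsrc l == u)) f l =
  if d then \sum_(w : vert F | p w == u) f (inr w)
  else \sum_(e : edge E | src e == u) f (inl e).
Proof.
rewrite big_sumType /=; case: d => /=.
  by rewrite big_pred0 ?add0r // => e.
by rewrite [X in _ + X]big_pred0 ?addr0 // => e.
Qed.

Lemma rep_rel x y : textile_rel x y -> rep x = rep y.
Proof.
move=> h; apply/funext => psi; apply/funext => x0; apply/funext => a.
case: h => {x y} /=.
- move=> u v; rewrite /op_vert; case: (u =P v) => [->|h] /=; rewrite /op_vert.
    by case: ifP => // ->.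
  by case: (u =P base x0) => // e1; case: (v =P base x0) => // e2; case: h; rewrite e1 e2.
- move=> e; rewrite /op_vert /op_letter; case: (hd _ x0 =P _) => [h|]; last by case: ifP.
  by rewrite -(lsrc_hd false) [hd _ _]h eqxx.
- move=> e; rewrite /op_vert /op_letter; case: (hd _ x0 =P _) => [h|//].
  by rewrite -lrng_hd [hd _ _]h eqxx.
- move=> e; rewrite /op_vert /op_ghost /=; by case: ifP => // ->.
- move=> e; rewrite /op_vert /op_ghost; case: eqP => // h.
  by rewrite (base_cons hT h) eqxx.
- move=> e; rewrite /op_vert /op_letter; case: (hd _ x0 =P _) => [h|]; last by case: ifP.
  by rewrite -(lsrc_hd true) [hd _ _]h eqxx.
- move=> e; rewrite /op_vert /op_letter; case: (hd _ x0 =P _) => [h|//].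
  by rewrite -lrng_hd [hd _ _]h eqxx.
- move=> e; rewrite /op_vert /op_ghost /=; by case: ifP => // ->.
- move=> e; rewrite /op_vert /op_ghost; case: eqP => // h.
  by rewrite (base_cons hT h) eqxx.
- by move=> e e'; rewrite op_ghost_letter // (inj_eq (@inl_inj _ _)); case: ifP.
- by move=> e e'; rewrite op_ghost_letter // (inj_eq (@inr_inj _ _)); case: ifP.
- move=> u _; rewrite rep_big /= -(sum_hd false) sum_letter_split.
  by apply: eq_bigr => e _; rewrite op_letter_ghost.
- move=> u _; rewrite rep_big /= -(sum_hd true) sum_letter_split.
  by apply: eq_bigr => e _; rewrite op_letter_ghost.
(* Relation (T5): both sides test whether the square of [x0] at the origin is [f], one by left side
   and top, the other by bottom and right side. *)
- move=> f; rewrite /op_letter /= !xt_tl /= -xt_q -xt_rng.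
  rewrite -[tl false (tl true _)]tl_shift -!addrA [- _ - _]addrC.
  rewrite !(inj_eq (@inl_inj _ _)) !(inj_eq (@inr_inj _ _)).
  have [->|hf] := eqVneq (xt x0 (0, 0)%N) f; first by rewrite !eqxx.
  case: eqP => [e1|_].
    case: eqP => [e2|_]; first by rewrite (square_sq_inj hT e1 e2) eqxx in hf.
    case: eqP => [e3|//]; case: eqP => [e4|//].
    by rewrite (square_rp_inj hT e4 e3) eqxx in hf.
  case: eqP => [e3|//]; case: eqP => [e4|//].
  by rewrite (square_rp_inj hT e4 e3) eqxx in hf.
- move=> f; rewrite /op_ghost /= hom_rng; case: eqP => [h|//].
  have h1 : lrng (inl (hom1 q f) : letter T) = base x0 by [].
  have h2 : lrng (inr (rng f) : letter T) = base x0 by rewrite /= hom_rng.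
  rewrite (base_cons hT h1) (base_cons hT h2) /= hom_src hom_rng !eqxx.
  by rewrite (cons_square hT h) addrAC.
Qed.

Lemma rep_pres x y : pres_eq (@textile_rel k T) x y -> rep x = rep y.
Proof.
elim=> {x y}.
- exact: rep_rel.
- by [].
- by [].
- by move=> x y z _ -> _ ->.
- by move=> x x' y y' _ ex _ ey /=; apply/funext => psi; rewrite ex ey.
- by move=> c x x' _ ex /=; apply/funext => psi; rewrite ex.
- by move=> x x' y y' _ ex _ ey /=; apply/funext => psi; rewrite ex ey.
all: intros; apply/funext => ?; apply/funext => ?; apply/funext => ? /=.
- by rewrite addrA.
- by rewrite addrC.
- by rewrite add0r.
- by rewrite mulN1r addNr.
- by rewrite mulrA.
- by rewrite mul1r.
- by rewrite mulrDr.
- by rewrite mulrDl.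
- by [].
- by [].
- by rewrite rep_add.
- by [].
- by rewrite rep_scale.
Qed.
End Representation.

(** * The spans of products of a path and a ghost path *)

Section Algebra.
Variables (k : fieldType) (T : textile_system).
Local Notation E := (tE T).
Local Notation p := (tp T).
Local Notation q := (tq T).
Local Notation expr := (expr k (textile_gen T)).
Local Notation A := (textile_algebra k T).
Local Notation cls := (@pcls k (textile_gen T) (@textile_rel k T)).
Local Infix "**" := (@textile_mul k T) (at level 40, left associativity).

Definition letter_gen (l : letter T) : textile_gen T :=
  match l with inl e => GE e | inr w => GW w end.
Definition ghost_gen (l : letter T) : textile_gen T :=
  match l with inl e => GEs e | inr w => GWs w end.

Definition Vt (u : vert E) : A := cls (EGen (GV u)).
Definition St (l : letter T) : A := cls (EGen (letter_gen l)).
Definition Gt (l : letter T) : A := cls (EGen (ghost_gen l)).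

Lemma tmulA (x y z : A) : x ** (y ** z) = x ** y ** z.
Proof. exact: pmulA. Qed.
Lemma tmulDl (x y z : A) : (x + y) ** z = x ** z + y ** z.
Proof. exact: pmulDl. Qed.
Lemma tmulDr (x y z : A) : x ** (y + z) = x ** y + x ** z.
Proof. exact: pmulDr. Qed.
Lemma tmulZl c (x y : A) : (c *: x) ** y = c *: (x ** y).
Proof. exact: pmulZl. Qed.
Lemma tmulZr c (x y : A) : x ** (c *: y) = c *: (x ** y).
Proof. exact: pmulZr. Qed.
Lemma tmul0l (x : A) : 0 ** x = 0.
Proof. by have := tmulZl 0 0 x; rewrite !scale0r. Qed.
Lemma tmul0r (x : A) : x ** 0 = 0.
Proof. by have := tmulZr 0 x 0; rewrite !scale0r. Qed.

Lemma tmul_suml (I : finType) (P : pred I) (f : I -> A) y :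
  (\sum_(i | P i) f i) ** y = \sum_(i | P i) f i ** y.
Proof.
by apply: (big_morph (fun x => x ** y)) => [x z|]; rewrite ?tmulDl ?tmul0l.
Qed.

Lemma tmul_sumr (I : finType) (P : pred I) (f : I -> A) y :
  y ** (\sum_(i | P i) f i) = \sum_(i | P i) y ** f i.
Proof.
by apply: (big_morph (fun x => y ** x)) => [x z|]; rewrite ?tmulDr ?tmul0r.
Qed.

Lemma cls_big (I : finType) (P : pred I) (f : I -> expr) :
  cls (\big[@EAdd k _/EZero]_(i | P i) f i) = \sum_(i | P i) cls (f i).
Proof. by apply: (big_morph cls) => // x y; rewrite -padd_cls. Qed.

Lemma cls_mul x y : cls (EMul x y) = cls x ** cls y.
Proof. by rewrite /textile_mul pmul_cls. Qed.

Lemma VtVt u v : Vt u ** Vt v = if u == v then Vt u else 0.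
Proof. by rewrite -cls_mul (pcls_rel (T1 k u v)); case: ifP. Qed.

Lemma Vt_lsrc_St l : Vt (lsrc l) ** St l = St l.
Proof. by rewrite -cls_mul; case: l => l; apply: pcls_rel; constructor. Qed.
Lemma St_Vt_lrng l : St l ** Vt (lrng l) = St l.
Proof. by rewrite -cls_mul; case: l => l; apply: pcls_rel; constructor. Qed.
Lemma Vt_lrng_Gt l : Vt (lrng l) ** Gt l = Gt l.
Proof. by rewrite -cls_mul; case: l => l; apply: pcls_rel; constructor. Qed.
Lemma Gt_Vt_lsrc l : Gt l ** Vt (lsrc l) = Gt l.
Proof. by rewrite -cls_mul; case: l => l; apply: pcls_rel; constructor. Qed.

Lemma VtSt u l : Vt u ** St l = if u == lsrc l then St l else 0.
Proof. by rewrite -Vt_lsrc_St tmulA VtVt; case: eqP => [->|]; rewrite ?tmul0l ?Vt_lsrc_St. Qed.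
Lemma GtVt u l : Gt l ** Vt u = if lsrc l == u then Gt l else 0.
Proof.
by rewrite -{1}Gt_Vt_lsrc -tmulA VtVt; case: eqP => _; rewrite ?tmul0r ?Gt_Vt_lsrc.
Qed.

Lemma GtSt l l' : dir l = dir l' ->
  Gt l ** St l' = if l == l' then Vt (lrng l) else 0.
Proof.
rewrite -cls_mul; case: l l' => [l|l] [l'|l'] // _.
  by rewrite (inj_eq (@inl_inj _ _)) (pcls_rel (T3E k l l')); case: ifP.
by rewrite (inj_eq (@inr_inj _ _)) (pcls_rel (T3W k l l')); case: ifP.
Qed.

Hypothesis hT : left_resolving T.

(** Composable letters of different directions are adjacent sides of a square; the lifting
    properties supply it, and (T5) exchanges the pair with the other two sides. *)
Lemma letter_swap a b : dir a != dir b -> lrng a = lsrc b ->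
  exists a' b', [/\ dir a' = dir a, dir b' = dir b,
    St a ** St b = St b' ** St a' & Gt b ** Gt a = Gt a' ** Gt b'].
Proof.
case: a b => [e|w] [e'|w'] //= _ h.
  have [f [[f1 f2] _]] := hT.1 w' e (esym h).
  exists (inl (hom1 q f)), (inr (src f)).
  split=> //; rewrite -!cls_mul -f1 -f2; symmetry; apply: pcls_rel; [exact: T5|exact: T5s].
have [f [[f1 f2] _]] := hT.2 w e' h.
exists (inr (rng f)), (inl (hom1 p f)).
by split=> //; rewrite -!cls_mul -f1 -f2; apply: pcls_rel; [exact: T5|exact: T5s].
Qed.

(** * Products and expansions in the spans *)

Hypotheses (hE : sink_free E) (hp : surjective_hom p).

(** Sink-freeness and surjectivity of [p] make both sums nonempty, so (T4) holds at every vertex in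
    both directions. *)
Lemma Vt_sum d u :
  Vt u = \sum_(l : letter T | (dir l == d) && (lsrc l == u)) St l ** Gt l.
Proof.
rewrite sum_letter_split; case: d.
  rewrite [LHS](pcls_rel (@T4W k T u _)); last first.
    by have [w hw] := hp.1 u; apply/card_gt0P; exists w; rewrite inE hw.
  by rewrite cls_big; apply: eq_bigr => w _; rewrite cls_mul.
rewrite [LHS](pcls_rel (@T4E k T u _)); last first.
  by have [e he] := hE u; apply/card_gt0P; exists e; rewrite inE he.
by rewrite cls_big; apply: eq_bigr => w _; rewrite cls_mul.
Qed.

(* The span of the products [mu nu^*] of a path [mu] of degree [m] and the ghost
   of a path [nu] of degree [n]. *)
Inductive path_span : nat * nat -> nat * nat -> A -> Prop :=
| span_vert u : path_span (0, 0)%N (0, 0)%N (Vt u)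
| span_letter l m n z : path_span m n z -> path_span (degS (dir l) m) n (St l ** z)
| span_ghost l m n z : path_span m n z -> path_span m (degS (dir l) n) (z ** Gt l)
| span0 m n : path_span m n 0
| spanD m n y z : path_span m n y -> path_span m n z -> path_span m n (y + z)
| spanZ c m n z : path_span m n z -> path_span m n (c *: z).

Lemma span_sum m n (I : finType) (P : pred I) (f : I -> A) :
  (forall i, P i -> path_span m n (f i)) -> path_span m n (\sum_(i | P i) f i).
Proof. by move=> h; apply: big_ind => //; [exact: span0 | move=> *; exact: spanD]. Qed.

Lemma span_Vt_mul u m n z : path_span m n z -> path_span m n (Vt u ** z).
Proof.
elim=> {m n z} [v|l m n z hz _|l m n z _ hz|m n|m n y z _ hy _ hz|c m n z _ hz].
- by rewrite VtVt; case: ifP => _; [exact: span_vert | exact: span0].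
- rewrite tmulA VtSt; case: ifP => _; first exact: span_letter.
  by rewrite tmul0l; exact: span0.
- by rewrite tmulA; exact: span_ghost.
- by rewrite tmul0r; exact: span0.
- by rewrite tmulDr; exact: spanD.
- by rewrite tmulZr; exact: spanZ.
Qed.

Lemma span_mul_Vt u m n z : path_span m n z -> path_span m n (z ** Vt u).
Proof.
elim=> {m n z} [v|l m n z _ hz|l m n z hz _|m n|m n y z _ hy _ hz|c m n z _ hz].
- by rewrite VtVt; case: ifP => _; [exact: span_vert | exact: span0].
- by rewrite -tmulA; exact: span_letter.
- rewrite -tmulA GtVt; case: ifP => _; first exact: span_ghost.
  by rewrite tmul0r; exact: span0.
- by rewrite tmul0l; exact: span0.
- by rewrite tmulDl; exact: spanD.
- by rewrite tmulZl; exact: spanZ.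
Qed.

(** If the outermost letter of [z] has the direction of the ghost, (T3) cancels them; otherwise the
    ghost has to be moved past that letter by means of squares. *)
Lemma span_Gt_mul l m n z : path_span (degS (dir l) m) n z ->
  path_span m n (Gt l ** z).
Proof.
move=> h; move: {-1}(degS _ m) (erefl (degS (dir l) m)) h => m' Em h.
elim: h l m Em => {m' n z} [v|l m n z hz IH|l m n z _ hz|m n|m n y z _ hy _ hz|
  c m n z _ hz] l' m'.
- by move/degSN0.
- have [e|e] := eqVneq (dir l') (dir l).
    rewrite -e => /degS_inj ->; rewrite tmulA GtSt //.
    by case: ifP => _; [exact: span_Vt_mul | rewrite tmul0l; exact: span0].
  case/(degS_neq_inv e) => m0 [-> Em].
  (* The range of [l] is expanded in the direction of [l']. Each [l b] becomes [b' a'], the ghost of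
     [l'] meets [b'], and the ghost of [b] times [z] falls under the induction hypothesis. *)
  rewrite -[St l]St_Vt_lrng (Vt_sum (dir l')) -tmulA tmul_suml !tmul_sumr.
  apply: span_sum => b /andP[/eqP db /eqP sb].
  have [|a' [b' [da' db' eab _]]] := @letter_swap l b _ (esym sb).
    by rewrite db eq_sym.
  have -> : St l ** (St b ** Gt b ** z) = St b' ** (St a' ** (Gt b ** z)).
    by rewrite !tmulA eab.
  rewrite tmulA GtSt ?db' //; case: ifP => _; last by rewrite tmul0l; exact: span0.
  by apply: span_Vt_mul; rewrite -da'; apply: span_letter; apply: IH; rewrite db.
- by move=> Em; rewrite tmulA; apply: span_ghost; exact: hz.
- by move=> _; rewrite tmul0r; exact: span0.
- by move=> Em; rewrite tmulDr; apply: spanD; [exact: hy | exact: hz].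
- by move=> Em; rewrite tmulZr; apply: spanZ; exact: hz.
Qed.

Lemma span_mul_St l m n z : path_span m (degS (dir l) n) z ->
  path_span m n (z ** St l).
Proof.
move=> h; move: {-1}(degS _ n) (erefl (degS (dir l) n)) h => n' En h.
elim: h l n En => {m n' z} [v|l m n z _ hz|l m n z hz IH|m n|m n y z _ hy _ hz|
  c m n z _ hz] l' n'.
- by move/degSN0.
- by move=> En; rewrite -tmulA; apply: span_letter; exact: hz.
- have [e|e] := eqVneq (dir l') (dir l).
    rewrite -e => /degS_inj ->; rewrite -tmulA GtSt //.
    by case: ifP => _; [exact: span_mul_Vt | rewrite tmul0r; exact: span0].
  case/(degS_neq_inv e) => n0 [-> En].
  rewrite -[Gt l]Vt_lrng_Gt (Vt_sum (dir l')) tmul_suml tmul_sumr tmul_suml.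
  apply: span_sum => b /andP[/eqP db /eqP sb].
  have [|a' [b' [da' db' _ eab]]] := @letter_swap l b _ (esym sb).
    by rewrite db eq_sym.
  have -> : z ** (St b ** Gt b ** Gt l) ** St l' = z ** St b ** Gt a' ** (Gt b' ** St l').
    by rewrite !tmulA -[in LHS](tmulA _ (Gt b)) eab !tmulA.
  rewrite GtSt ?db' //; case: ifP => _; last by rewrite tmul0r; exact: span0.
  by apply: span_mul_Vt; rewrite -da'; apply: span_ghost; apply: IH; rewrite db.
- by move=> _; rewrite tmul0l; exact: span0.
- by move=> En; rewrite tmulDl; apply: spanD; [exact: hy | exact: hz].
- by move=> En; rewrite tmulZl; apply: spanZ; exact: hz.
Qed.

(** (T4) inserted at the middle vertex: mu nu^* is the sum of the mu l l^* nu^*. *)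
Lemma span_expand1 d m n z : path_span m n z -> path_span (degS d m) (degS d n) z.
Proof.
elim=> {m n z} [v|l m n z _ hz|l m n z _ hz|m n|m n y z _ hy _ hz|c m n z _ hz].
- rewrite (Vt_sum d); apply: span_sum => l /andP[/eqP <- _].
  by rewrite -{1}St_Vt_lrng; apply/span_ghost/span_letter/span_vert.
- by rewrite degS_swap; exact: span_letter.
- by rewrite [degS d (degS _ n)]degS_swap; exact: span_ghost.
- exact: span0.
- exact: spanD.
- exact: spanZ.
Qed.

Definition deg_add (m n : nat * nat) : nat * nat := (m.1 + n.1, m.2 + n.2)%N.

Lemma deg_addC m n : deg_add m n = deg_add n m.
Proof. by rewrite /deg_add addnC [(m.2 + _)%N]addnC. Qed.

Lemma deg_add_degS d m n : deg_add (degS d m) n = degS d (deg_add m n).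
Proof. by case: d. Qed.

Lemma deg_add_zsub m n m' n' : zsub m n = zsub m' n' ->
  deg_add m' n = deg_add m n'.
Proof. by case=> h1 h2; congr pair; lia. Qed.

Lemma zsub_deg_add e m n : zsub (deg_add e m) (deg_add e n) = zsub m n.
Proof. by congr pair => /=; lia. Qed.

Lemma span_expand e m n z : path_span m n z ->
  path_span (deg_add e m) (deg_add e n) z.
Proof.
move=> h; elim/deg_ind: e => [|d e IH]; first by case: m n h => ? ? [].
by rewrite !deg_add_degS; exact: span_expand1.
Qed.

(** The ghosts at the end of [y] are absorbed one at a time by [z], whose left degree is the same
    [n]. *)
Lemma span_mul0 m n l y z : path_span m n y -> path_span n l z -> path_span m l (y ** z).
Proof.
move=> h; elim: h l z => {m n y} [v|a m n y _ hy|a m n y _ hy|m n|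
  m n y y' _ hy _ hy'|c m n y _ hy] l z hz.
- exact: span_Vt_mul.
- by rewrite -tmulA; apply: span_letter; exact: hy.
- by rewrite -tmulA; apply: hy; exact: span_Gt_mul.
- by rewrite tmul0l; exact: span0.
- by rewrite tmulDl; apply: spanD; [exact: hy | exact: hy'].
- by rewrite tmulZl; apply: spanZ; exact: hy.
Qed.

(** Two elements of equal degree lie in a common span after expansion, which gives closure under
    sums. *)
Lemma homog_span a z : textile_homog k T a z <->
  exists m n, a = zsub m n /\ path_span m n z.
Proof.
split.
  elim=> {a z} [g|a b x y _ [m [n [-> hx]]] _ [m' [n' [-> hy]]]|a|
    a x y _ [m [n [-> hx]]] _ [m' [n' [e hy]]]|a c x _ [m [n [-> hx]]]].
  - have hS l : exists m n, unit_vec (dir l) = zsub m n /\ path_span m n (St l).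
      exists (degS (dir l) (0, 0)%N), (0, 0)%N; split.
        by rewrite zsub_degSl zsubnn add0r.
      by rewrite -St_Vt_lrng; apply/span_letter/span_vert.
    have hG l : exists m n, - unit_vec (dir l) = zsub m n /\ path_span m n (Gt l).
      exists (0, 0)%N, (degS (dir l) (0, 0)%N); split.
        by rewrite zsub_degSr zsubnn add0r.
      by rewrite -Vt_lrng_Gt; apply/span_ghost/span_vert.
    case: g => g; [|exact: (hS (inr g))|exact: (hS (inl g))
      |exact: (hG (inr g))|exact: (hG (inl g))].
    by exists (0, 0)%N, (0, 0)%N; split; [rewrite zsubnn | exact: span_vert].
  (* Expanding [x] by [m'] and [y] by [n] makes both middle degrees equal to the sum of [m'] and
     [n]. *)
  - exists (deg_add m' m), (deg_add n n'); split; first by congr pair => /=; lia.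
    apply: (span_mul0 (span_expand m' hx)).
    by rewrite deg_addC; exact: span_expand.
  - exists (`|Num.max a.1 0|, `|Num.max a.2 0|)%N, (`|Num.max (- a.1) 0|, `|Num.max (- a.2) 0|)%N.
    split; last exact: span0.
    by case: a => a b; congr pair => /=; lia.
  - exists (deg_add m' m), (deg_add m' n); split; first by rewrite zsub_deg_add.
    apply: spanD; first exact: span_expand.
    by rewrite (deg_add_zsub e) deg_addC; exact: span_expand.
  - by exists m, n; split=> //; exact: spanZ.
move=> [m [n [->]]]; elim=> {m n z} [v|l m n z _ hz|l m n z _ hz|m n|
  m n y z _ hy _ hz|c m n z _ hz].
- by rewrite zsubnn; exact: (PHGen _ _ (GV v)).
- rewrite zsub_degSl addrC; apply: PHMul hz.
  by case: l => l; [exact: (PHGen _ _ (GE l)) | exact: (PHGen _ _ (GW l))].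
- rewrite zsub_degSr; apply: PHMul; first exact: hz.
  by case: l => l; [exact: (PHGen _ _ (GEs l)) | exact: (PHGen _ _ (GWs l))].
- exact: PH0.
- exact: PHAdd.
- exact: PHScale.
Qed.

(** The sum of all vertices is a left unit, E^0 being finite, and (T4) expands each vertex. In
    [span_inj] this reduces [z] to the products [Gt l ** z], which lie in a smaller span. *)
Lemma span_letter_sum d m n z : path_span m n z ->
  z = \sum_(l : letter T | dir l == d) St l ** (Gt l ** z).
Proof.
have -> : \sum_(l | dir l == d) St l ** (Gt l ** z) = (\sum_u Vt u) ** z.
  rewrite tmul_suml (partition_big (@lsrc T) predT) //=; apply: eq_bigr => u _.
  by rewrite (Vt_sum d) tmul_suml; apply: eq_bigr => l _; rewrite tmulA.
have pick (u : vert E) (x : A) : \sum_v (if v == u then x else 0) = x.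
  by rewrite -big_mkcond big_pred1_eq.
elim=> {m n z} [u|l m n z hz _|l m n z _ hz|m n|m n y z _ hy _ hz|c m n z _ hz].
- rewrite tmul_suml -[LHS](pick u); apply: eq_bigr => v _.
  by rewrite VtVt; case: eqP => [->|].
- rewrite tmulA tmul_suml -{1}(pick (lsrc l) (St l)); congr (_ ** _).
  by apply: eq_bigr => v _; rewrite VtSt.
- by rewrite tmulA -hz.
- by rewrite tmul0r.
- by rewrite tmulDr -hy -hz.
- by rewrite tmulZr -hz.
Qed.

Lemma span_ghost_sum d m n z : path_span m n z ->
  z = \sum_(l : letter T | dir l == d) z ** St l ** Gt l.
Proof.
have -> : \sum_(l | dir l == d) z ** St l ** Gt l = z ** (\sum_u Vt u).
  rewrite tmul_sumr (partition_big (@lsrc T) predT) //=; apply: eq_bigr => u _.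
  by rewrite (Vt_sum d) tmul_sumr; apply: eq_bigr => l _; rewrite tmulA.
have pick (u : vert E) (x : A) : \sum_v (if u == v then x else 0) = x.
  by rewrite -big_mkcond (eq_bigl (pred1 u)) ?big_pred1_eq // => v; rewrite eq_sym.
elim=> {m n z} [u|l m n z _ hz|l m n z hz _|m n|m n y z _ hy _ hz|c m n z _ hz].
- rewrite tmul_sumr -[LHS](pick u); apply: eq_bigr => v _.
  by rewrite VtVt; case: eqP => [->|].
- by rewrite -tmulA -hz.
- rewrite -tmulA tmul_sumr -{1}(pick (lsrc l) (Gt l)); congr (_ ** _).
  by apply: eq_bigr => v _; rewrite GtVt.
- by rewrite tmul0l.
- by rewrite tmulDl -hy -hz.
- by rewrite tmulZl -hz.
Qed.

Lemma span_00 z : path_span (0, 0)%N (0, 0)%N z ->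
  exists c : vert E -> k, z = \sum_u c u *: Vt u.
Proof.
have [m Em] : exists m, m = (0, 0)%N by exists (0, 0)%N.
have [n En] : exists n, n = (0, 0)%N by exists (0, 0)%N.
rewrite -{1}Em -En => h.
elim: h Em En => {m n z} [u|l m n z _ _|l m n z _ _|m n|m n y z _ hy _ hz|
  c m n z _ hz].
- move=> _ _; exists (fun v => (v == u)%:R).
  rewrite (bigD1 u) //= eqxx scale1r big1 ?addr0 // => v /negPf ->.
  by rewrite scale0r.
- by move/degSN0.
- by move=> _ /degSN0.
- by move=> _ _; exists (fun=> 0); rewrite big1 // => v _; rewrite scale0r.
- move=> e1 e2; have [c ->] := hy e1 e2; have [c' ->] := hz e1 e2.
  exists (fun v => c v + c' v); rewrite -big_split /=.
  by apply: eq_bigr => v _; rewrite scalerDl.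
- move=> e1 e2; have [c' ->] := hz e1 e2; exists (fun v => c * c' v).
  by rewrite scaler_sumr; apply: eq_bigr => v _; rewrite scalerA.
Qed.

Lemma homog_decomp (z : A) : exists s : seq ((int * int) * A),
  (forall i, i \in s -> textile_homog k T i.1 i.2) /\ z = \sum_(i <- s) i.2.
Proof.
rewrite -[z]preprK; elim: (prepr z) => {z} [g||x [s [hs sE]] y [t [ht tE]]|
  c x [s [hs sE]]|x [s [hs sE]] y [t [ht tE]]].
- exists [:: (textile_deg g, cls (EGen g))]; rewrite big_seq1; split=> //.
  by move=> i; rewrite inE => /eqP ->; exact: PHGen.
- by exists [::]; rewrite big_nil.
- exists (s ++ t); rewrite big_cat -sE -tE -padd_cls; split=> //.
  by move=> i; rewrite mem_cat => /orP[/hs|/ht].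
- exists [seq (i.1, c *: i.2) | i <- s]; rewrite big_map -scaler_sumr -sE -pscale_cls.
  by split=> // i /mapP[j /hs h ->]; exact: PHScale.
- exists [seq (i.1 + j.1, i.2 ** j.2) | i <- s, j <- t]; split.
    by move=> _ /allpairsP[[i j] [/hs hi /ht hj ->]]; exact: PHMul.
  rewrite cls_mul sE tE big_allpairs_dep /= (big_morph _ (fun a b => tmulDl a b _) (tmul0l _)).
  by apply: eq_bigr => i _; rewrite (big_morph _ (tmulDr _) (tmul0r _)).
Qed.
End Algebra.

(** * The map to functions on the groupoid *)

Section Representing.
Variables (k : fieldType) (T : textile_system).
Local Notation E := (tE T).
Local Notation p := (tp T).
Local Notation X := (XT T).
Local Notation G := (textile_groupoid T).
Local Notation expr := (expr k (textile_gen T)).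
Local Notation A := (textile_algebra k T).
Local Notation M := (X -> int * int -> k).
Local Notation cls := (@pcls k (textile_gen T) (@textile_rel k T)).
Local Infix "**" := (@textile_mul k T) (at level 40, left associativity).

Definition delta (y : X) : M := fun z a => if (z == y) && (a == 0) then 1 else 0.

(* For an arrow (x, a, y), [ev z y x a] is the value at (x, a, y) of the function
   on the groupoid that represents [z]. *)
Definition ev (z : A) (y : X) : M := rep (prepr z) (delta y).

Definition steinberg_map (z : A) : G -> k^o :=
  fun g => ev z (gsrc g) (grng g) (gdeg g).

(** * Values of sums and products *)

Hypothesis hT : left_resolving T.

Lemma rep_cls x (psi : M) : rep (prepr (cls x)) psi = rep x psi.
Proof. by rewrite (rep_pres hT (prepr_cls _ x)). Qed.

Lemma ev_mul y z v : ev (y ** z) v = rep (prepr y) (ev z v).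
Proof. by rewrite /ev /textile_mul /pmul rep_cls. Qed.

Lemma evD y z v x a : ev (y + z) v x a = ev y v x a + ev z v x a.
Proof. by rewrite /ev -[y + z]/(cls (EAdd (prepr y) (prepr z))) rep_cls. Qed.

Lemma evZ c z v x a : ev (c *: z) v x a = c * ev z v x a.
Proof. by rewrite /ev -[c *: z]/(cls (EScale c (prepr z))) rep_cls. Qed.

Lemma ev0 v x a : ev 0 v x a = 0.
Proof. by rewrite -(scale0r (0 : A)) evZ mul0r. Qed.

Lemma ev_sum (I : finType) (P : pred I) (f : I -> A) v x a :
  ev (\sum_(i | P i) f i) v x a = \sum_(i | P i) ev (f i) v x a.
Proof. by elim/big_rec2: _ => [|i y1 y2 _ <-]; rewrite ?ev0 ?evD. Qed.

Lemma ev_St_mul l z v x a : ev (St k l ** z) v x a =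
  if hd (dir l) x == l then ev z v (tl (dir l) x) (a - unit_vec (dir l)) else 0.
Proof. by rewrite ev_mul rep_cls; case: l. Qed.

Lemma ev_Gt_mul l z v x a : ev (Gt k l ** z) v x a =
  if lrng l == base x then ev z v (cons l x) (a + unit_vec (dir l)) else 0.
Proof. by rewrite ev_mul rep_cls; case: l. Qed.

Lemma ev_Vt u v x a :
  ev (Vt k u) v x a = if [&& u == base v, x == v & a == 0] then 1 else 0.
Proof.
rewrite /ev rep_cls /= /op_vert /delta; case: (x =P v) => [->|_] /=.
  by case: (u == base v).
by rewrite if_same andbF.
Qed.

(** Right multiplication moves the point: [St l] sends the delta function at (v, 0) to a translate
    of the one at [cons l v], or to 0, and the operators commute with scalars and translations. *)
Lemma ev_mul_St l z v x a : ev (z ** St k l) v x a =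
  if lrng l == base v then ev z (cons l v) x (a - unit_vec (dir l)) else 0.
Proof.
have -> : ev (z ** St k l) v = rep (prepr z)
    (fun x a => (if lrng l == base v then 1 else 0) *
       delta (cons l v) x (a - unit_vec (dir l))).
  rewrite ev_mul; congr (rep _ _); apply/funext => y; apply/funext => b.
  rewrite /ev rep_cls.
  transitivity (op_letter l (delta v) y b); first by case: (l).
  rewrite /op_letter /delta; case: (eqVneq (lrng l) (base v)) => h; last first.
    rewrite mul0r; case: eqP => // e; case: eqP => //= e'.
    by move: h; rewrite -e lrng_hd e' eqxx.
  have [h1 h2] := consP hT h; rewrite mul1r.
  have -> : (y == cons l v) = (hd (dir l) y == l) && (tl (dir l) y == v).
    apply/eqP/andP => [->|[/eqP e1 /eqP e2]]; first by rewrite h1 h2.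
    by rewrite -(cons_hd_tl hT (dir l) y) e1 e2.
  by case: eqP.
rewrite rep_scale // (rep_translate hT _ (- _) (delta (cons l v))).
by case: ifP => _; rewrite ?mul1r ?mul0r.
Qed.

Lemma ev_mul_Gt l z v x a : ev (z ** Gt k l) v x a =
  if hd (dir l) v == l then ev z (tl (dir l) v) x (a + unit_vec (dir l)) else 0.
Proof.
have -> : ev (z ** Gt k l) v = rep (prepr z)
    (fun x a => (if hd (dir l) v == l then 1 else 0) *
       delta (tl (dir l) v) x (a + unit_vec (dir l))).
  rewrite ev_mul; congr (rep _ _); apply/funext => y; apply/funext => b.
  rewrite /ev rep_cls.
  transitivity (op_ghost l (delta v) y b); first by case: (l).
  rewrite /op_ghost /delta; case: (eqVneq (lrng l) (base y)) => h.
    have [h1 h2] := consP hT h.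
    have -> : (cons l y == v) = (hd (dir l) v == l) && (y == tl (dir l) v).
      apply/eqP/andP => [<-|[/eqP e1 /eqP e2]]; first by rewrite h1 h2.
      by rewrite -(cons_hd_tl hT (dir l) v) e1 -e2.
    by case: eqP => _; rewrite ?mul1r ?mul0r.
  case: (eqVneq (hd (dir l) v) l) => e; rewrite ?mul0r // mul1r.
  case: eqP => //= e'; move: h; rewrite e' -lrng_hd.
  by rewrite {1}e eqxx.
rewrite rep_scale // (rep_translate hT _ _ (delta (tl (dir l) v))).
by case: ifP => _; rewrite ?mul1r ?mul0r.
Qed.

Lemma ev_arrow z v x a : ev z v x a != 0 -> arrow_from x a v.
Proof.
have [s [hs sE]] := rep_kernel hT (prepr z) x; rewrite /ev sE => hne.
have [i hi] : exists2 i, i \in s & i.1 * delta v i.2.2 (a - i.2.1) != 0.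
  apply: contrapT => h; move/eqP: hne; apply; rewrite big_seq big1 // => i hi.
  by apply/eqP; apply: contrapT => hn; apply: h; exists i => //; apply/negP.
rewrite /delta; case: (i.2.2 =P v) => [<-|_] /=; last by rewrite mulr0 eqxx.
case: (a - i.2.1 =P 0) => [/eqP|_]; last by rewrite mulr0 eqxx.
by rewrite subr_eq0 => /eqP -> _; exact: hs.
Qed.

Lemma steinberg_map_eq0 z : (forall g, steinberg_map z g = 0) ->
  forall v x a, ev z v x a = 0.
Proof.
move=> h v x a; apply/eqP; apply: contrapT => /negP hne.
by move/eqP: (hne); apply; exact: (h (TextileArrow (ev_arrow hne))).
Qed.

Lemma steinberg_map_linear : linear steinberg_map.
Proof. by move=> c y z; apply/funext => g; rewrite /steinberg_map evD evZ. Qed.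

(** There may be infinitely many factorizations of [g]; a finite list suffices once it contains all
    those on whose first factor [f] does not vanish. *)
Lemma convolution_sum (f h : G -> k^o) g (r : seq (G * G)) : uniq r ->
  (forall ab, ab \in r -> exists c : gsrc ab.1 = grng ab.2, gmul c = g) ->
  (forall ab, (exists c : gsrc ab.1 = grng ab.2, gmul c = g) ->
     ab \notin r -> f ab.1 = 0) ->
  convolution f h g = \sum_(ab <- r) (f ab.1 * h ab.2 : k).
Proof.
move=> ur rP rC; rewrite /convolution [RHS]fsbig_seq //; symmetry.
apply: fsbig_widen.
  by move=> ab /= hab; exact: rP.
move=> ab [/= hc hr]; rewrite (rC _ hc) ?mul0r //; exact/negP.
Qed.

(** A factorization of [g] is determined by its first factor, and the first factors at which [y] can
    be nonzero are listed by the kernel of [y] at the range of [g]. *)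
Lemma steinberg_map_mul y z :
  steinberg_map (y ** z) = convolution (steinberg_map y) (steinberg_map z).
Proof.
apply/funext => g; rewrite {1}/steinberg_map ev_mul.
have [s [hs sE]] := rep_kernel hT (prepr y) (grng g).
(* The kernel may list a pair several times, whereas the convolution counts a factorization once;
   [evy] collects the repeated coefficients. *)
pose S := undup [seq i.2 | i <- s].
have evy v a : ev y v (grng g) a =
    \sum_(i <- s) i.1 * (if i.2 == (a, v) then 1 else 0).
  rewrite /ev sE; apply: eq_bigr => -[c [b w]] _; rewrite /delta /=.
  have -> : ((b, w) == (a, v)) = (b == a) && (w == v) by [].
  by rewrite subr_eq0 [a == b]eq_sym andbC.
(* [ar] sends (b, w) to the factorization with first factor (grng g, b, w), the second being its
   inverse times [g]; (g, g) is a mere default. *)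
have /choice[ar arP] : forall bz : (int * int) * X, exists ab : G * G,
    arrow_from (grng g) bz.1 bz.2 ->
    (exists c : gsrc ab.1 = grng ab.2, gmul c = g) /\
    gdeg ab.1 = bz.1 /\ gsrc ab.1 = bz.2.
  move=> [b w] /=; have [h|h] := pselect (arrow_from (grng g) b w); last by exists (g, g).
  pose a := TextileArrow h; have c : gsrc (ginv a) = grng g by [].
  exists (a, gmul c) => _; split=> //.
  have c' : gsrc a = grng (gmul c) by [].
  by exists c'; apply: textile_arrow_inj => //=; rewrite addrA subrr add0r.
have arS bz : bz \in S -> arrow_from (grng g) bz.1 bz.2.
  by rewrite mem_undup => /mapP[i /hs hi ->].
have fact (a b : G) (c : gsrc a = grng b) : gmul c = g ->
    [/\ grng a = grng g, gsrc b = gsrc g & gdeg b = gdeg g - gdeg a].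
  by move=> <-; split=> //=; rewrite addrAC subrr add0r.
rewrite (@convolution_sum _ _ _ [seq ar bz | bz <- S]).
- rewrite sE big_map [RHS]big_seq.
  transitivity (\sum_(bz <- S | bz \in S)
      (\sum_(i <- s) i.1 * (if i.2 == bz then 1 else 0)) *
      ev z (gsrc g) bz.2 (gdeg g - bz.1)); last first.
    apply: eq_bigr => bz /arS /arP[[c e] [e1 e2]].
    have [h1 h2 h3] := fact _ _ _ e.
    rewrite /steinberg_map h1 h2 h3 -c e1 e2 evy.
    by congr (_ * _); apply: eq_bigr => i _; case: bz {e1 e2 c e h1 h2 h3}.
  rewrite -big_seq; under [RHS]eq_bigr do rewrite mulr_suml.
  rewrite exchange_big /= big_seq [RHS]big_seq; apply: eq_bigr => i hi.
  rewrite (bigD1_seq i.2) ?undup_uniq ?mem_undup ?map_f //= eqxx mulr1 big1 ?addr0 //.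
  by move=> bz /negPf h; rewrite eq_sym h mulr0 mul0r.
- rewrite map_inj_in_uniq ?undup_uniq // => bz bz' /arS /arP[_ [e1 e2]] /arS /arP[_ [e3 e4]] e.
  by rewrite [bz]surjective_pairing [bz']surjective_pairing -e1 -e2 -e3 -e4 e.
- by move=> _ /mapP[bz /arS /arP[h _] ->].
- move=> [a b] /= [c e] hn; have [h1 h2 h3] := fact _ _ _ e.
  rewrite /steinberg_map h1 evy big_seq big1 // => i hi; case: eqP => [ei|]; last by rewrite mulr0.
  have hS : i.2 \in S by rewrite mem_undup map_f.
  case/negP: hn; apply/mapP; exists i.2 => //.
  have [[c' e'] [e1 e2]] := arP _ (arS _ hS); have [h1' h2' h3'] := fact _ _ _ e'.
  rewrite ei /= in e1 e2.
  have ea : a = (ar i.2).1 by apply: textile_arrow_inj; rewrite ?h1 ?h1' ?ei ?e1 ?e2.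
  rewrite [ar i.2]surjective_pairing -ea; congr pair; apply: textile_arrow_inj.
  + by rewrite -c -c' -ea.
  + by rewrite h3 h3' -ea.
  + by rewrite h2 h2'.
Qed.

(** * Supports and injectivity *)

Hypotheses (hE : sink_free E) (hp : surjective_hom p).

Lemma span_support m n z v x a : path_span m n z -> ev z v x a != 0 ->
  a = zsub m n /\ shift m x = shift n v.
Proof.
move=> h; elim: h v x a => {m n z} [u|l m n z _ hz|l m n z _ hz|m n|
  m n y z _ hy _ hz|c m n z _ hz] v x a.
- by rewrite ev_Vt zsubnn; case: and3P => [[_ /eqP -> /eqP ->]|]; rewrite ?eqxx.
- rewrite ev_St_mul; case: (hd _ x =P l) => [_|]; last by rewrite eqxx.
  by move/hz => [/eqP]; rewrite subr_eq -zsub_degSl => /eqP -> e; rewrite shift_degS.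
- rewrite ev_mul_Gt; case: (hd _ v =P l) => [_|]; last by rewrite eqxx.
  move/hz => [/eqP]; rewrite -[zsub m n](subrK (unit_vec (dir l))) -zsub_degSr.
  by rewrite (inj_eq (addIr _)) => /eqP -> e; rewrite shift_degS.
- by rewrite ev0 eqxx.
- rewrite evD; have [->|/hy//] := eqVneq (ev y v x a) 0.
  by rewrite add0r => /hz.
- by rewrite evZ mulf_eq0 negb_or => /andP[_ /hz].
Qed.

(** Each letter compares itself with the first letter of the range and strips it, each ghost does so
    at the source; in the end only [base] is read. *)
Lemma span_eqbox m n z v v' x x' : path_span m n z ->
  eqbox m x x' -> eqbox n v v' -> shift m x = shift n v -> shift m x' = shift n v' ->
  ev z v x (zsub m n) = ev z v' x' (zsub m n).
Proof.
move=> h; elim: h v v' x x' => {m n z} [u|l m n z _ hz|l m n z _ hz|m n|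
  m n y z _ hy _ hz|c m n z _ hz] v v' x x' hx hv.
- by rewrite !shift_deg0 !ev_Vt => -> ->; rewrite !eqxx ((eqbox0 _ _).1 hv).
- rewrite !shift_degS zsub_degSl !ev_St_mul addrK.
  have [<- hx'] := (eqbox_degS hT _ _ _ _).1 hx.
  by move=> e e'; case: eqP => // _; exact: hz.
- rewrite !shift_degS zsub_degSr !ev_mul_Gt subrK.
  have [<- hv'] := (eqbox_degS hT _ _ _ _).1 hv.
  by move=> e e'; case: eqP => // _; exact: hz.
- by rewrite !ev0.
- by move=> e e'; rewrite !evD (hy _ _ _ _ hx hv e e') (hz _ _ _ _ hx hv e e').
- by move=> e e'; rewrite !evZ (hz _ _ _ _ hx hv e e').
Qed.

(** Products with ghosts on the left and letters on the right lower the degrees and still have all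
    values 0, which reduces [z] to a combination of vertices. *)
Lemma span_inj m n z : path_span m n z -> (forall v x a, ev z v x a = 0) -> z = 0.
Proof.
elim/deg_ind: m z => [|d m IH] z; last first.
  move=> hz h0; rewrite (span_letter_sum hE hp d hz) big1 // => l /eqP dl.
  rewrite (IH (Gt k l ** z)) ?tmul0r // => [|v x a].
    by apply: span_Gt_mul => //; rewrite dl.
  by rewrite ev_Gt_mul h0; case: ifP.
elim/deg_ind: n z => [|d n IH] z; last first.
  move=> hz h0; rewrite (span_ghost_sum hE hp d hz) big1 // => l /eqP dl.
  rewrite (IH (z ** St k l)) ?tmul0l // => [|v x a].
    by apply: span_mul_St => //; rewrite dl.
  by rewrite ev_mul_St h0; case: ifP.
move=> /span_00[c ->] h0; rewrite big1 // => u _.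
(* The value at the unit of a path based at [u] is the coefficient of [u]. *)
have [x <-] := base_surj hT hE hp u.
have := h0 x x 0; rewrite ev_sum (bigD1 (base x)) //= big1 => [|w /negPf hw].
  by rewrite evZ ev_Vt !eqxx mulr1 addr0 => ->; rewrite scale0r.
by rewrite evZ ev_Vt hw mulr0.
Qed.

Lemma homog_support a z v x b : textile_homog k T a z -> ev z v x b != 0 -> b = a.
Proof. by move=> /(homog_span hT hE hp)[m [n [-> hz]]] /(span_support hz)[]. Qed.

Lemma homog_inj a z : textile_homog k T a z -> (forall v x b, ev z v x b = 0) -> z = 0.
Proof. by move=> /(homog_span hT hE hp)[m [n [_ hz]]]; exact: span_inj hz. Qed.

Lemma homog_sum a (s : seq ((int * int) * A)) :
  (forall i, i \in s -> textile_homog k T i.1 i.2) ->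
  textile_homog k T a (\sum_(i <- s | i.1 == a) i.2).
Proof.
move=> hs; rewrite big_seq_cond; apply: big_ind => [|y z|i /andP[hi /eqP <-]].
- exact: PH0.
- exact: PHAdd.
- exact: hs.
Qed.

Lemma ev_sum_seq (s : seq ((int * int) * A)) (P : pred ((int * int) * A)) v x a :
  ev (\sum_(i <- s | P i) i.2) v x a = \sum_(i <- s | P i) ev i.2 v x a.
Proof. by elim/big_rec2: _ => [|i y1 y2 _ <-]; rewrite ?ev0 ?evD. Qed.

(** Homogeneous components are supported in distinct degrees, so the values of each vanish along
    with those of their sum, and [homog_inj] applies. *)
Lemma steinberg_map_ker z : (forall g, steinberg_map z g = 0) -> z = 0.
Proof.
move=> /steinberg_map_eq0 h0; have [s [hs sE]] := homog_decomp z.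
have hcomp a : \sum_(i <- s | i.1 == a) i.2 = 0.
  apply: (homog_inj (homog_sum a hs)) => v x b; apply: contrapT => /eqP hne.
  move/eqP: (hne); apply; have <- := homog_support (homog_sum a hs) hne.
  rewrite ev_sum_seq -[RHS](h0 v x b) sE ev_sum_seq [RHS](bigID (fun i => i.1 == b)) /=.
  rewrite [X in _ + X]big_seq_cond [X in _ + X]big1 ?addr0 // => i /andP[/hs hi hib].
  by apply/eqP; apply: contraNT hib => /(homog_support hi) ->.
rewrite sE; pose U := undup [seq i.1 | i <- s].
transitivity (\sum_(a <- U) \sum_(i <- s | i.1 == a) i.2); last by rewrite big1.
rewrite (exchange_big_dep predT) //= big_seq [RHS]big_seq; apply: eq_bigr => i hi.
rewrite big_mkcond (bigD1_seq i.1) ?undup_uniq ?mem_undup ?map_f //= eqxx big1 ?addr0 //.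
by move=> a /negPf h; rewrite eq_sym h.
Qed.

Lemma steinberg_map_inj : injective steinberg_map.
Proof.
move=> y z e; apply/eqP; rewrite -subr_eq0; apply/eqP/steinberg_map_ker => g.
have := congr1 (fun f : G -> k^o => f g) e; rewrite /steinberg_map => e'.
by rewrite -scaleN1r evD evZ e' mulN1r subrr.
Qed.
End Representing.

(** * The topology of the groupoid *)

Section Topology.
Variable T : textile_system.
Local Notation F := (tF T).
Local Notation X := (XT T).
Local Notation G := (textile_groupoid T).
Local Notation C := (quadrant_config T).

Definition config_agree (K : nat) (c c' : C) : Prop :=
  forall i j, (i < K)%N -> (j < K)%N -> c (i, j) = c' (i, j).

(** Every finite set of coordinates lies in some [0, K)^2. The filter generated by the cylinders
    over these squares converges to [c] coordinatewise; conversely such a cylinder is a finite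
    intersection of conditions on one coordinate. *)
Lemma config_nbhsP (c : C) (P : set C) :
  nbhs c P <-> exists K, forall c', config_agree K c c' -> P c'.
Proof.
split=> [|[K hK]].
  pose FF : set_system C := [set Q | exists K, forall c', config_agree K c c' -> Q c'].
  have FFf : Filter FF.
    split; first by exists 0%N.
      move=> A B [K hK] [L hL]; exists (maxn K L) => c' h.
      by split; [apply: hK | apply: hL] => i j hi hj; apply: h; rewrite leq_max ?hi ?hj ?orbT.
    by move=> A B AB [K hK]; exists K => c' /hK /AB.
  suff : FF --> c by apply.
  apply/cvg_sup => -[i j] A /= [_ [[B Bop <-] Bc sBA]].
  exists (maxn i j).+1 => c' h; apply: sBA => /=.
  by rewrite -h // ltnS ?leq_maxl ?leq_maxr.
suff h : nbhs c (config_agree K c) by apply: filterS h => c'; exact: hK.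
have coord ij : nbhs c [set c' : C | c ij = c' ij].
  have h : nbhs c (proj ij @^-1` [set c ij]).
    apply: (@proj_continuous _ (fun=> discrete_topology (edge F)) ij c).
    exact: discrete_set1.
  by apply: filterS h => c' /= <-.
have hf : nbhs c [set c' : C | forall ij : 'I_K * 'I_K,
    c (ij.1 : nat, ij.2 : nat) = c' (ij.1 : nat, ij.2 : nat)].
  apply: (@filter_forall _ _ (fun (ij : 'I_K * 'I_K) c' =>
    c (ij.1 : nat, ij.2 : nat) = c' (ij.1 : nat, ij.2 : nat)) (nbhs c)) => ij.
  exact: coord.
by apply: filterS hf => c' h i j hi hj; exact: (h (Ordinal hi, Ordinal hj)).
Qed.

Lemma XT_nbhsP (x : X) (P : set X) :
  nbhs x P <-> exists K, forall y, agree K x y -> P y.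
Proof.
split=> [[_ [[B Bop <-] Bx sBP]]|[K hK]].
  have /config_nbhsP[K hK] : nbhs (set_val x) B by apply: open_nbhs_nbhs.
  by exists K => y hy; apply: sBP; apply: hK.
have h : nbhs (set_val x) (config_agree K (set_val x)) by apply/config_nbhsP; exists K.
have h' : nbhs x (set_val @^-1` config_agree K (set_val x)).
  exact: (@initial_continuous X C set_val x).
by apply: filterS h' => y; exact: hK.
Qed.

Lemma agree_le K L (x y : X) : (K <= L)%N -> agree L x y -> agree K x y.
Proof. by move=> h hxy i j hi hj; apply: hxy; exact: leq_trans h. Qed.

Lemma agree_trans K (x y z : X) : agree K x y -> agree K y z -> agree K x z.
Proof. by move=> h h' i j hi hj; rewrite h ?h'. Qed.

Lemma agree_shift K m (x y : X) : agree (K + (m.1 + m.2)) x y ->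
  agree K (shift m x) (shift m y).
Proof. by move=> h i j hi hj; rewrite !shiftE; apply: h => /=; lia. Qed.

Lemma XT_continuous (f : X -> X) :
  (forall K x, exists L, forall y, agree L x y -> agree K (f x) (f y)) ->
  continuous f.
Proof.
move=> h x P /XT_nbhsP[K hK]; have [L hL] := h K x.
by apply/XT_nbhsP; exists L => y /hL /hK.
Qed.

Lemma shift_continuous m : continuous (@shift T m).
Proof. by apply: XT_continuous => K x; exists (K + (m.1 + m.2))%N => y /agree_shift. Qed.

Lemma XT_open (P : set X) :
  (forall x, P x -> exists K, forall y, agree K x y -> P y) -> open P.
Proof. by move=> h; rewrite openE => x /h hx; apply/XT_nbhsP. Qed.

(** * Local homeomorphisms and neighbourhoods of arrows *)

Hypothesis hT : left_resolving T.

Lemma eqbox_sym m (x y : X) : eqbox m x y -> eqbox m y x.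
Proof. by move=> [h1 h2 h3]; split=> [i j ? ?|i j ? ?|]; rewrite ?h1 ?h2 ?h3. Qed.

Lemma eqbox_trans m (x y z : X) : eqbox m x y -> eqbox m y z -> eqbox m x z.
Proof.
move=> [h1 h2 h3] [k1 k2 k3].
by split=> [i j ? ?|i j ? ?|]; rewrite ?h1 ?h2 ?h3 ?k1 ?k2 ?k3.
Qed.

Lemma eqbox_shift e m (x y : X) : eqbox (deg_add e m) x y ->
  eqbox e (shift m x) (shift m y).
Proof.
rewrite deg_addC; elim/deg_ind: m x y => [|d m IH] x y.
  by rewrite !shift_deg0; case: e.
by rewrite deg_add_degS !shift_degS => /(eqbox_degS hT) [_ /IH].
Qed.

Lemma eqbox_base m (x y : X) : eqbox m x y ->
  base (shift m x) = base (shift m y).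
Proof. by move=> h; apply/eqbox0; apply: eqbox_shift; case: m h. Qed.

Lemma shift_deg_add e m (x : X) :
  shift (deg_add e m) x = shift e (shift m x).
Proof. by rewrite shift_shift. Qed.

(** Both [shift m x'] and [shift n y'] start like the common point [shift m x = shift n y] up to
    degree [e], and beyond [e] they coincide by assumption. *)
Lemma arrow_box e m n (x x' y y' : X) :
  shift m x = shift n y ->
  shift (deg_add e m) x' = shift (deg_add e n) y' ->
  eqbox (deg_add e m) x x' -> eqbox (deg_add e n) y y' ->
  shift m x' = shift n y'.
Proof.
move=> exy exy' hx hy; apply: (@eqbox_shift_inj _ hT e).
  apply: eqbox_trans (eqbox_shift hy); apply: eqbox_trans (eqbox_sym (eqbox_shift hx)) _.
  by rewrite exy; split.
by rewrite -!shift_deg_add.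
Qed.

Lemma cons_continuous l : continuous (@cons T l).
Proof.
apply: XT_continuous => K x; have [h|h] := eqVneq (lrng l) (base x).
  exists K.+2 => y hxy; have hb : base x = base y by rewrite /base hxy.
  have h' : lrng l = base y by rewrite -hb.
  apply: (@eqbox_agree _ hT (degS (dir l) (K, K))); try by case: (dir l).
  apply/(eqbox_degS hT); have [h1 h2] := consP hT h; have [h3 h4] := consP hT h'.
  rewrite h1 h2 h3 h4; split=> //.
  exact: (@agree_eqbox _ K.+2).
exists K.+1 => y hxy; have hb : base x = base y by rewrite /base hxy.
(* Where [l] does not fit, [cons l] is the identity, and the same holds at all points with the same
   base. *)
have stuck z : lrng l != base z -> cons l z = z.
  rewrite /cons => /eqP hz; case: pselect => // hz'; case: hz.
  by have [z' [<- <-]] := hz'; rewrite dir_hd lrng_hd.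
by rewrite !stuck -?hb //; exact: agree_le hxy.
Qed.

(** The letters of the initial path of [x] are prepended one by one; [g] is the local inverse of the
    shift. *)
Lemma prepend_exists m (x : X) : exists g : X -> X, continuous g /\
  forall z, base z = base (shift m x) ->
    eqbox m x (g z) /\ shift m (g z) = z.
Proof.
elim/deg_ind: m x => [|d m IH] x.
  exists id; split; first by move=> ?; exact: cvg_id.
  by move=> z; rewrite !shift_deg0 => h; split=> //; apply/eqbox0.
have [g [gc gP]] := IH (tl d x); exists (cons (hd d x) \o g); split.
  by move=> z; apply: continuous_comp; [exact: gc | exact: cons_continuous].
move=> z; rewrite !shift_degS => /gP[g1 g2] /=.
have h : lrng (hd d x) = base (g z) by rewrite lrng_hd; case: g1.
have [h1 h2] := consP hT h; rewrite dir_hd in h1 h2; rewrite h2; split=> //.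
by apply/(eqbox_degS hT); rewrite h1 h2.
Qed.

Lemma eqbox_homeo m (x : X) : restricts_to_homeo (shift m)
  [set y | eqbox m x y] [set z | base z = base (shift m x)].
Proof.
have [g [gc gP]] := prepend_exists m x.
split; first by apply: continuous_subspaceT; exact: shift_continuous.
exists g; split.
- exact: continuous_subspaceT.
- by move=> _ [y /= hy <-]; rewrite (eqbox_base hy).
- by move=> _ [z /= /gP[h _] <-].
- move=> y /= hy; have [h1 h2] := gP (shift m y) (esym (eqbox_base hy)).
  by apply: (@eqbox_shift_inj _ hT m) => //; apply: eqbox_trans hy; exact: eqbox_sym.
- by move=> z /= /gP[].
Qed.

Definition arrow_box_nbhs m n K (g : G) : set G :=
  [set h | [/\ gdeg h = zsub m n, shift m (grng h) = shift n (gsrc h),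
     agree K (grng g) (grng h) & agree K (gsrc g) (gsrc h)]].

Lemma eqbox_open m (x : X) : open [set y | eqbox m x y].
Proof.
apply: XT_open => y /= hy; exists (m.1 + m.2).+1 => z hz.
by apply: eqbox_trans hy _; apply: (agree_eqbox _ _ hz); lia.
Qed.

(** Any presentation (m, n) of [g] can describe its neighbourhoods. A basic set with another
    presentation is compared at a common larger degree; conversely, cylinders of large degree give a
    basic set inside [arrow_box_nbhs]. *)
Lemma groupoid_nbhsP m n (g : G) (P : set G) :
  gdeg g = zsub m n -> shift m (grng g) = shift n (gsrc g) ->
  nbhs g P <-> exists K, arrow_box_nbhs m n K g `<=` P.
Proof.
move=> dg eg; split=> [|[K hK]].
  pose FF : set_system G := [set Q | exists K, arrow_box_nbhs m n K g `<=` Q].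
  have FFf : Filter FF.
    split; first by exists 0%N.
      move=> A B [K hK] [L hL]; exists (maxn K L) => h [h1 h2 h3 h4].
      split; [apply: hK|apply: hL]; split=> //.
      + exact: agree_le (leq_maxl _ _) h3.
      + exact: agree_le (leq_maxl _ _) h4.
      + exact: agree_le (leq_maxr _ _) h3.
      + exact: agree_le (leq_maxr _ _) h4.
    by move=> A B AB [K hK]; exists K => h /hK /AB.
  suff : FF --> g by apply.
  move=> A /=; rewrite (@nbhsE G) => -[_ [[B sB <-] [D BD Dg] sUBA]].
  rewrite nbhs_filterE; apply: filterS sUBA _; apply: (@filterS _ _ _ D).
    by move=> ? ?; exists D.
  have /sB [S sS ISeD] := BD; rewrite -ISeD; apply: filter_bigI => Z ZS.
  have Zg : Z g by move: Dg; rewrite -ISeD => /(_ _ ZS).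
  have /sS := ZS; rewrite inE => -[m' [n' [U [V [W [[oU oV _] _ _ EZ]]]]]].
  rewrite EZ in Zg; rewrite EZ; case: Zg => Ux Vy dg' eg'.
  have /XT_nbhsP[K hK] : nbhs (grng g) U by apply: open_nbhs_nbhs.
  have /XT_nbhsP[L hL] : nbhs (gsrc g) V by apply: open_nbhs_nbhs.
  exists (K + L + (m.1 + m.2) + (m'.1 + m'.2) + (n'.1 + n'.2)).+1 => h [h1 h2 h3 h4].
  split.
  + by apply: hK; apply: agree_le h3; lia.
  + by apply: hL; apply: agree_le h4; lia.
  + by rewrite h1 -dg dg'.
  + apply: (arrow_box (e := m)) eg' _ _ _.
    (* As m - n = m' - n', shifting the equation at (m, n) by [m'] gives one at (m + m', m + n'). *)
    * rewrite deg_addC shift_deg_add h2 -shift_deg_add -(@deg_add_zsub m n m' n') //.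
      by rewrite -dg.
    * by apply: (agree_eqbox _ _ h3) => /=; lia.
    * by apply: (agree_eqbox _ _ h4) => /=; lia.
(* Adding (K, K) to both degrees forces agreement on [0, K)^2 at both ends. *)
pose e := (K, K); pose U := [set y | eqbox (deg_add e m) (grng g) y].
pose V := [set y | eqbox (deg_add e n) (gsrc g) y].
pose Z := textile_basic_set (deg_add e m) (deg_add e n) U V.
have eg' : shift (deg_add e m) (grng g) = shift (deg_add e n) (gsrc g).
  by rewrite !shift_deg_add eg.
have Zg : Z g by split=> //; rewrite zsub_deg_add.
have bZ : textile_basis Z.
  exists (deg_add e m), (deg_add e n), U, V.
  exists [set z | base z = base (shift (deg_add e m) (grng g))].
  split=> //; first split; try exact: eqbox_open.
  - by apply: XT_open => z /= <-; exists 1%N => y h; rewrite /base h.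
  - exact: eqbox_homeo.
  - by rewrite eg'; exact: eqbox_homeo.
have oZ : open Z.
  exists [set Z]; last first.
    by rewrite predeqE => ?; split=> [[_ ->]|] //; exists Z.
  move=> _ ->; exists [fset Z]%fset; first by move=> ? /fset1P ->; exact/mem_set.
  apply/seteqP; split=> [h hZ|h hZ i]; first by apply: (hZ Z); exact/fset1P.
  by move=> /= /fset1P ->.
rewrite nbhsE; exists Z => // h [Ux Vy dh eh]; apply: hK; split.
- by rewrite dh zsub_deg_add.
- exact: arrow_box eg eh Ux Vy.
- by apply: (eqbox_agree hT _ _ Ux); rewrite /= leq_addr.
- by apply: (eqbox_agree hT _ _ Vy); rewrite /= leq_addr.
Qed.
End Topology.

(** * The image *)

Section Surjectivity.
Variables (k : fieldType) (T : textile_system).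
Local Notation E := (tE T).
Local Notation F := (tF T).
Local Notation p := (tp T).
Local Notation X := (XT T).
Local Notation G := (textile_groupoid T).
Local Notation C := (quadrant_config T).
Local Notation A := (textile_algebra k T).

(** * Compactness of the slices *)

Hypothesis hT : left_resolving T.

Definition degree_slice m n : set G :=
  [set g | gdeg g = zsub m n /\ shift m (grng g) = shift n (gsrc g)].

Lemma config_compact : compact [set: C].
Proof.
have := @tychonoff _ (fun _ : nat * nat => discrete_topology (edge F)) (fun=> setT).
have -> : [set f : nat * nat -> discrete_topology (edge F) | forall i, setT (f i)] = setT.
  by apply/seteqP; split.
by apply=> _; apply: finite_compact; exact: (@finite_finset (edge F)).
Qed.

(** The slice encoded by the endpoints of its arrows, inside a compact product; as the degree is
    fixed, nothing is lost. *)
Definition slice_graph m n : set (C * C) :=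
  [set cd | exists2 g, degree_slice m n g &
     cd.1 = xt (grng g) /\ cd.2 = xt (gsrc g)].

(** The graph is closed: each defining equation involves finitely many coordinates, so its failure
    persists on a cylinder. *)
Lemma slice_graph_compact m n : compact (slice_graph m n).
Proof.
apply: (@subclosed_compact _ _ [set: C * C]) => //; last first.
  by rewrite -setXTT; apply: compact_setX; exact: config_compact.
rewrite -openC openE => -[c d] hcd.
have far K : (forall c' d', config_agree K c c' -> config_agree K d d' ->
    ~ slice_graph m n (c', d')) -> nbhs (c, d) (~` slice_graph m n).
  move=> h; exists (config_agree K c, config_agree K d).
    by split; apply/config_nbhsP; exists K.
  by move=> [c' d'] [/= hc hd]; exact: h.
have graphP c' d' : slice_graph m n (c', d') <->
    [/\ XTset c', XTset d' &
        forall i j, c' (i + m.1, j + m.2)%N = d' (i + n.1, j + n.2)%N].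
  split=> [[g [_ eg] [/= -> ->]]|[hc hd h]].
    split=> [||i j]; [exact: xtP | exact: xtP |].
    by have := congr1 (fun x => xt x (i, j)) eg; rewrite !shiftE.
  pose x : X := SigSub (mem_set hc); pose y : X := SigSub (mem_set hd).
  have exy : shift m x = shift n y.
    by apply: xt_inj => -[i j]; rewrite !shiftE; exact: h.
  have ag : exists m' n', zsub m n = zsub m' n' /\ shift m' x = shift n' y by exists m, n.
  by exists (TextileArrow ag).
have bad (c' : C) : ~ XTset c' -> exists K, forall c'', config_agree K c' c'' -> ~ XTset c''.
  move=> /existsNP[i /existsNP[j hij]]; exists (i + j).+2 => c'' h h'.
  by apply: hij; rewrite !h; try lia; exact: h'.
have [hc|/bad[K hK]] := pselect (XTset c); last first.
  by apply: (far K) => c' d' h _ /graphP[/(hK _ h)].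
have [hd|/bad[K hK]] := pselect (XTset d); last first.
  by apply: (far K) => c' d' _ h /graphP[_ /(hK _ h)].
have /existsNP[i /existsNP[j hij]] :
    ~ forall i j, c (i + m.1, j + m.2)%N = d (i + n.1, j + n.2)%N.
  by move=> h; apply: hcd; apply/graphP.
apply: (far (i + j + m.1 + m.2 + n.1 + n.2).+1) => c' d' h h' /graphP[_ _ /(_ i j)].
rewrite -h; [rewrite -h'; [exact: hij|lia|lia]|lia|lia].
Qed.

(** The map [f] rebuilds an arrow from its endpoints. It is continuous on the graph, since
    neighbourhoods at the fixed presentation (m, n) only ask for agreement of endpoints. *)
Lemma degree_slice_compact m n : compact (degree_slice m n).
Proof.
have [[g0 _]|h0] := pselect (degree_slice m n !=set0); last first.
  have -> : degree_slice m n = set0.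
    by rewrite -subset0 => g hg; apply: h0; exists g.
  exact: compact0.
have /choice[f fP] : forall cd : C * C, exists g, slice_graph m n cd ->
    degree_slice m n g /\ (cd.1 = xt (grng g) /\ cd.2 = xt (gsrc g)).
  move=> cd; have [[g hg hcd]|h] := pselect (slice_graph m n cd); first by exists g.
  by exists g0 => /h.
have -> : degree_slice m n = f @` slice_graph m n.
  apply/seteqP; split=> [g hg|_ [cd /fP[h _] <-] //].
  have hgr : slice_graph m n (xt (grng g) : C, xt (gsrc g) : C) by exists g.
  exists (xt (grng g) : C, xt (gsrc g) : C) => //.
  have [[d' _] [/= e1 e2]] := fP _ hgr.
  apply: textile_arrow_inj; first by apply: xt_inj => i; rewrite -e1.
    by rewrite d' hg.1.
  by apply: xt_inj => i; rewrite -e2.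
apply: continuous_compact (@slice_graph_compact m n).
rewrite continuous_subspace_in => cd; rewrite inE => hcd.
have [[dg eg] [e1 e2]] := fP _ hcd.
move=> P /(groupoid_nbhsP hT _ dg eg)[K hK].
rewrite /nbhs /= -nbhs_subspace_in; last by [].
exists (config_agree K cd.1, config_agree K cd.2).
  by split; apply/config_nbhsP; exists K.
move=> cd' [/= h1 h2] /fP[[dg' eg'] [e1' e2']]; apply: hK; split=> //.
  by move=> i j hi hj; have := h1 i j hi hj; rewrite e1 e1'.
by move=> i j hi hj; have := h2 i j hi hj; rewrite e2 e2'.
Qed.

Lemma locally_constant_closed (f : G -> k) : locally_constant f ->
  closed [set g | f g != 0].
Proof.
move=> lf; rewrite -openC openE => g /= /negP; rewrite negbK => /eqP fg.
by apply: filterS (lf g) => h /= ->; rewrite fg eqxx.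
Qed.

Lemma steinberg_compact_support (f : G -> k^o) (K : set G) :
  locally_constant (f : G -> k) -> compact K -> (forall g, f g != 0 -> K g) ->
  steinberg_algebra k T f.
Proof.
move=> lf cK fK; split=> //; rewrite /compactly_supported.
rewrite -(closure_id _).1; last exact: locally_constant_closed.
by apply: subclosed_compact cK _ => //; exact: locally_constant_closed.
Qed.

Lemma steinberg_support (f : G -> k^o) : steinberg_algebra k T f ->
  compact [set g | f g != 0].
Proof.
move=> [lf cf]; move: cf; rewrite /compactly_supported -(closure_id _).1 //.
exact: locally_constant_closed.
Qed.

Lemma steinberg0 : steinberg_algebra k T (0 : G -> k^o).
Proof.
apply: (@steinberg_compact_support _ set0); [|exact: compact0|].
  by move=> g; apply: (filterS _ (@filterT _ (nbhs g) _)).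
by move=> g; rewrite eqxx.
Qed.

Lemma steinbergD (f h : G -> k^o) : steinberg_algebra k T f ->
  steinberg_algebra k T h -> steinberg_algebra k T (f + h).
Proof.
move=> hf hh; apply: (@steinberg_compact_support _ ([set g | f g != 0] `|` [set g | h g != 0])).
- move=> g; near=> g'; rewrite !fctE; congr (_ + _); near: g'.
    exact: hf.1.
  exact: hh.1.
- by apply: compactU; exact: steinberg_support.
- move=> g hg; have [e|] := eqVneq (f g) 0; last by left.
  by right; move: hg; rewrite fctE e add0r.
Unshelve. all: by end_near.
Qed.

(** * The image is the Steinberg algebra *)

Hypotheses (hE : sink_free E) (hp : surjective_hom p).

(** Near an arrow of degree m - n, membership in the slice (m, n) does not change, by [arrow_box] in
    both directions; on the slice, [span_eqbox] gives local constancy. *)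
Lemma span_steinberg m n (z : A) : path_span m n z ->
  steinberg_algebra k T (steinberg_map z).
Proof.
move=> hz; apply: (@steinberg_compact_support _ (degree_slice m n)).
- have off v x b : ~ (b = zsub m n /\ shift m x = shift n v) -> ev z v x b = 0.
    by move=> hb; apply: contrapT => /eqP/(span_support hT hz).
  move=> g; have [m' [n' [dg eg]]] := textile_arrowP g.
  apply/(groupoid_nbhsP hT _ dg eg).
  exists (m.1 + m.2 + n.1 + n.2 + m'.1 + m'.2 + n'.1 + n'.2).+1 => h [dh eh hr hs].
  rewrite /steinberg_map dh dg.
  have [e|hne] := pselect (zsub m' n' = zsub m n); last by rewrite !off // => -[].
  have e1 := deg_add_zsub (esym e).
  have hr1 : eqbox (deg_add m' m) (grng g) (grng h).
    by apply: (agree_eqbox _ _ hr) => /=; lia.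
  have hs1 : eqbox (deg_add m' n) (gsrc g) (gsrc h).
    by apply: (agree_eqbox _ _ hs) => /=; lia.
  have gm : shift (deg_add m' m) (grng g) = shift (deg_add m' n) (gsrc g).
    by rewrite deg_addC shift_deg_add eg -shift_deg_add e1 deg_addC.
  have hm : shift (deg_add m' m) (grng h) = shift (deg_add m' n) (gsrc h).
    by rewrite deg_addC shift_deg_add eh -shift_deg_add e1 deg_addC.
  rewrite e.
  have [eg'|ng] := pselect (shift m (grng g) = shift n (gsrc g)).
    have eh' := arrow_box hT eg' hm hr1 hs1.
    symmetry; apply: (span_eqbox hT hz) => //.
      by apply: (agree_eqbox _ _ hr) => /=; lia.
    by apply: (agree_eqbox _ _ hs) => /=; lia.
  have nh : shift m (grng h) <> shift n (gsrc h).
    by move=> eh'; apply: ng; apply: (arrow_box hT eh' gm); exact: eqbox_sym.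
  by rewrite !off // => -[].
- exact: degree_slice_compact.
- by move=> g /(span_support hT hz).
Qed.

Lemma steinberg_map_steinberg (z : A) : steinberg_algebra k T (steinberg_map z).
Proof.
have [s [hs ->]] := homog_decomp z; rewrite big_seq.
apply: (big_ind (fun z => steinberg_algebra k T (steinberg_map z))).
- have -> : steinberg_map (0 : A) = 0 by apply/funext => g; rewrite /steinberg_map ev0.
  exact: steinberg0.
- move=> x y hx hy; have -> : steinberg_map (x + y) = steinberg_map x + steinberg_map y.
    by apply/funext => g; rewrite /steinberg_map evD.
  exact: steinbergD.
- by move=> i /hs /(homog_span hT hE hp)[m [n [_ /span_steinberg]]].
Qed.

(* A function on the arrows of degree [m - n] that only depends on the path of
   degree [m] at the range and on the path of degree [n] at the source. *)
Definition slice_function m n (h : X -> X -> int * int -> k) : Prop :=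
  (forall v x a, h v x a != 0 -> a = zsub m n /\ shift m x = shift n v) /\
  (forall v v' x x', eqbox m x x' -> eqbox n v v' ->
     shift m x = shift n v -> shift m x' = shift n v' ->
     h v x (zsub m n) = h v' x' (zsub m n)).

(** Converse of [span_support] and [span_eqbox]: letters are stripped first from the range, then
    from the source. *)
Lemma slice_function_span m n h : slice_function m n h ->
  exists2 z : A, path_span m n z & forall v x a, ev z v x a = h v x a.
Proof.
elim/deg_ind: m h => [|d m IH] h; last first.
  move=> [hS hI].
  (* For [l] of direction [d], [hl l] is the product of the ghost of [l] with [h], a slice function
     of degrees (m, n). *)
  pose hl (l : letter T) v x a := if lrng l == base x
    then h v (cons l x) (a + unit_vec (dir l)) else 0.
  have /choice[z zP] : forall l : letter T, exists z : A, dir l = d ->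
      path_span m n z /\ forall v x a, ev z v x a = hl l v x a.
    move=> l; have [dl|] := pselect (dir l = d); last by exists 0.
    have [|z hz zE] := IH (hl l); last by exists z.
    split=> [v x a|v v' x x' hx hv e e'].
      rewrite /hl; case: (lrng l =P base x) => [hb|]; last by rewrite eqxx.
      have [_ h2] := consP hT hb; rewrite dl in h2 *.
      move/hS => [/eqP]; rewrite zsub_degSl (inj_eq (addIr _)) => /eqP ->.
      by rewrite shift_degS h2.
    have [_ _ hb] := hx; rewrite /hl -hb; case: eqP => // hb1.
    have hb2 : lrng l = base x' by rewrite -hb.
    have [h1 h2] := consP hT hb1; have [h3 h4] := consP hT hb2.
    rewrite dl -zsub_degSl; rewrite dl in h1 h2 h3 h4.
    apply: hI => //; rewrite ?shift_degS ?h2 ?h4 //.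
    by apply/(eqbox_degS hT); rewrite h1 h2 h3 h4.
  exists (\sum_(l : letter T | dir l == d) textile_mul (St k l) (z l)).
    apply: span_sum => l /eqP dl; rewrite -dl; apply: span_letter.
    by have [] := zP l dl.
  move=> v x a; rewrite (ev_sum hT) (bigD1 (hd d x)) ?dir_hd //= big1 ?addr0.
    have [_ zE] := zP (hd d x) (dir_hd _ _).
    rewrite (ev_St_mul hT) dir_hd eqxx zE /hl lrng_hd eqxx (cons_hd_tl hT) dir_hd.
    by rewrite subrK.
  move=> l /andP[/eqP dl hl']; rewrite (ev_St_mul hT) dl eq_sym.
  by rewrite (negPf hl').
elim/deg_ind: n h => [|d n IH] h; last first.
  move=> [hS hI].
  pose hl (l : letter T) v x a := if lrng l == base v
    then h (cons l v) x (a - unit_vec (dir l)) else 0.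
  have /choice[z zP] : forall l : letter T, exists z : A, dir l = d ->
      path_span (0, 0)%N n z /\ forall v x a, ev z v x a = hl l v x a.
    move=> l; have [dl|] := pselect (dir l = d); last by exists 0.
    have [|z hz zE] := IH (hl l); last by exists z.
    split=> [v x a|v v' x x' hx hv e e'].
      rewrite /hl; case: (lrng l =P base v) => [hb|]; last by rewrite eqxx.
      have [_ h2] := consP hT hb; rewrite dl in h2 *.
      move/hS => [/eqP]; rewrite zsub_degSr (inj_eq (addIr _)) => /eqP ->.
      by rewrite shift_degS h2.
    have [_ _ hb] := hv; rewrite /hl -hb; case: eqP => // hb1.
    have hb2 : lrng l = base v' by rewrite -hb.
    have [h1 h2] := consP hT hb1; have [h3 h4] := consP hT hb2.
    rewrite dl -zsub_degSr; rewrite dl in h1 h2 h3 h4.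
    apply: hI => //; rewrite ?shift_degS ?h2 ?h4 //.
    by apply/(eqbox_degS hT); rewrite h1 h2 h3 h4.
  exists (\sum_(l : letter T | dir l == d) textile_mul (z l) (Gt k l)).
    apply: span_sum => l /eqP dl; rewrite -dl; apply: span_ghost.
    by have [] := zP l dl.
  move=> v x a; rewrite (ev_sum hT) (bigD1 (hd d v)) ?dir_hd //= big1 ?addr0.
    have [_ zE] := zP (hd d v) (dir_hd _ _).
    rewrite (ev_mul_Gt hT) dir_hd eqxx zE /hl lrng_hd eqxx (cons_hd_tl hT) dir_hd.
    by rewrite addrK.
  move=> l /andP[/eqP dl hl']; rewrite (ev_mul_Gt hT) dl eq_sym.
  by rewrite (negPf hl').
(* Now [h] lives on the units and depends only on the base, so any point [r u] over [u] supplies the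
   coefficient of [u]. *)
move=> [hS hI]; have /choice[r rP] := base_surj hT hE hp.
exists (\sum_u h (r u) (r u) 0 *: Vt k u).
  by apply: span_sum => u _; apply: spanZ; exact: span_vert.
move=> v x a; rewrite (ev_sum hT).
under eq_bigr do rewrite (evZ hT) (ev_Vt k hT).
have hr u : base u = base (r (base u)) by rewrite rP.
have hE0 u : h u u 0 = h (r (base u)) (r (base u)) 0.
  by rewrite -(zsubnn (0, 0)%N); apply: hI => //; exact/eqbox0.
rewrite (bigD1 (base v)) //= eqxx big1 ?addr0 => [|u /negPf ->]; last by rewrite mulr0.
rewrite -hE0; case: (x =P v) => [->|xv] /=; last first.
  rewrite mulr0; apply/esym/eqP; apply: contrapT => /negP /hS[_].
  by rewrite !shift_deg0.
case: (a =P 0) => [->|a0]; rewrite ?mulr1 ?mulr0 //.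
by apply/esym/eqP; apply: contrapT => /negP /hS[]; rewrite zsubnn.
Qed.

(** Local constancy at [g], with one bound [N] for both the size of the presentation and the range
    of agreement. *)
Definition tame (f : G -> k) (N : nat) (g : G) : Prop :=
  exists m n, [/\ (m.1 + m.2 + n.1 + n.2 <= N)%N, degree_slice m n g &
    forall h, arrow_box_nbhs m n N g h -> f h = f g].

(** Each arrow of the support has a neighbourhood on which all large [N] work; compactness of the
    support makes [N] uniform. *)
Lemma steinberg_tame (f : G -> k^o) : steinberg_algebra k T f ->
  exists N, forall g, f g != 0 -> tame f N g.
Proof.
move=> hf; have /compact_near_coveringP := steinberg_support hf.
move=> /(_ nat \oo (fun N g => tame f N g)) [|N _ hN]; last first.
  by exists N => g hg; apply: (hN N) => //=.
move=> g _; have [m [n [dg eg]]] := textile_arrowP g.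
have /(groupoid_nbhsP hT _ dg eg)[K hK] := hf.1 g.
exists (arrow_box_nbhs m n K g, [set N | (K + (m.1 + m.2 + n.1 + n.2) <= N)%N]).
  split; last by exists (K + (m.1 + m.2 + n.1 + n.2))%N.
  by apply/(groupoid_nbhsP hT _ dg eg); exists K.
move=> [g' N] [/= hg' hN]; have [dg' eg' hr hs] := hg'.
exists m, n; split; [lia | by [] |] => h [dh eh hr' hs'].
rewrite (hK _ hg') (hK h) //; split=> //.
  by apply: agree_trans hr _; apply: agree_le hr'; lia.
by apply: agree_trans hs _; apply: agree_le hs'; lia.
Qed.

Lemma zsub_surj N (a : int * int) : exists m n,
  [/\ a = zsub m n, (N <= m.1)%N, (N <= m.2)%N, (N <= n.1)%N & (N <= n.2)%N].
Proof.
exists (N + `|Num.max a.1 0|, N + `|Num.max a.2 0|)%N.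
exists (N + `|Num.max (- a.1) 0|, N + `|Num.max (- a.2) 0|)%N.
by split=> /=; try lia; case: a => a b; congr pair => /=; lia.
Qed.

(** When all coordinates of [m] and [n] exceed [N], presentations of size at most [N] and degree [a]
    extend to (m, n), and equal initial paths agree as far as tameness asks. So the part of [f] of
    degree [a] is a slice function. *)
Lemma tame_component (f : G -> k^o) N a :
  (forall g, f g != 0 -> tame f N g) ->
  exists2 z : A, textile_homog k T a z &
    forall g, steinberg_map z g = if gdeg g == a then f g else 0.
Proof.
move=> hN; have [m [n [-> m1 m2 n1 n2]]] := zsub_surj N.+1 a.
pose h v x b := if pselect (arrow_from x b v) is left ar
  then (if b == zsub m n then f (TextileArrow ar) else 0) else 0.
have hE0 (g : G) : h (gsrc g) (grng g) (gdeg g) = if gdeg g == zsub m n then f g else 0.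
  rewrite /h; case: pselect => [ar|[]]; last exact: textile_arrowP.
  by congr (if _ then f _ else _); exact: textile_arrow_inj.
have fS g : gdeg g = zsub m n -> f g != 0 -> exists m' n' e,
    [/\ m = deg_add e m', n = deg_add e n', shift m' (grng g) = shift n' (gsrc g) &
      forall h, arrow_box_nbhs m' n' N g h -> f h = f g].
  move=> dg /hN[m' [n' [hb [dg' eg] hc]]].
  exists m', n', (m.1 - m'.1, m.2 - m'.2)%N; rewrite dg in dg'; case: dg' => d1 d2.
  by split=> //; [rewrite [LHS]surjective_pairing | rewrite [LHS]surjective_pairing];
    congr pair => /=; lia.
have fI g g' : gdeg g = zsub m n -> gdeg g' = zsub m n ->
    shift m (grng g') = shift n (gsrc g') ->
    eqbox m (grng g) (grng g') -> eqbox n (gsrc g) (gsrc g') -> f g != 0 -> f g' = f g.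
  move=> dg dg' eg' hr hs /(fS _ dg)[m' [n' [e [em en eg hc]]]].
  apply: hc; split.
  - by rewrite dg' em en zsub_deg_add.
  - by rewrite em en in eg' hr hs; exact: (arrow_box hT eg eg').
  - by apply: (eqbox_agree hT _ _ hr); lia.
  - by apply: (eqbox_agree hT _ _ hs); lia.
have [|z hz zE] := @slice_function_span m n h.
  split=> [v x b|v v' x x' hx hv e e'].
    rewrite /h; case: pselect => [ar|]; last by rewrite eqxx.
    case: (b =P zsub m n) => [eb|_]; last by rewrite eqxx.
    subst b.
    move=> /fS[] // m' [n' [e [em en /= eg _]]].
    by split=> //; rewrite em en !shift_deg_add eg.
  have ar : arrow_from x (zsub m n) v by exists m, n.
  have ar' : arrow_from x' (zsub m n) v' by exists m, n.
  rewrite [LHS](hE0 (TextileArrow ar)) [RHS](hE0 (TextileArrow ar')) /= eqxx.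
  (* [fI] needs a nonzero value at its first arrow; if [f] vanishes there, the roles are
     exchanged. *)
  have [h0|h0] := eqVneq (f (TextileArrow ar)) 0; last by symmetry; exact: fI.
  rewrite h0; apply/esym/eqP; apply: contrapT => /negP h1.
  have := fI (TextileArrow ar') (TextileArrow ar) erefl erefl e (eqbox_sym hx) (eqbox_sym hv) h1.
  by move=> /esym; rewrite h0 => /eqP; rewrite (negPf h1).
exists z; first by apply/(homog_span hT hE hp); exists m, n.
by move=> g; rewrite /steinberg_map zE hE0.
Qed.

(** All arrows of the support have presentations of size at most [N], so only the finitely many
    degrees in [box] occur, and the components are added up. *)
Lemma steinberg_map_surj (f : G -> k^o) : steinberg_algebra k T f ->
  exists z : A, steinberg_map z = f.
Proof.
move=> /steinberg_tame[N hN]; have /choice[z zP] : forall a, exists z : A,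
    forall g, steinberg_map z g = if gdeg g == a then f g else 0.
  by move=> a; have [z _ zE] := tame_component a hN; exists z.
pose box : seq (int * int) := undup [seq zsub m n | m <- allpairs pair (iota 0 N.+1) (iota 0 N.+1),
  n <- allpairs pair (iota 0 N.+1) (iota 0 N.+1)].
exists (\sum_(a <- box) z a); apply/funext => g.
have -> : steinberg_map (\sum_(a <- box) z a) g = \sum_(a <- box) steinberg_map (z a) g.
  rewrite /steinberg_map; elim/big_rec2: _ => [|
    a y1 y2 _ <-]; first by rewrite (ev0 _ hT).
  by rewrite (evD hT).
under eq_bigr do rewrite zP.
have [/hN[m [n [hb [dg _] _]]]|/negPn/eqP ->] := boolP (f g != 0); last first.
  by rewrite big1 // => a _; case: ifP.
have hbox : gdeg g \in box.
  rewrite mem_undup; apply/allpairsPdep; exists m, n; split=> //.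
    apply/allpairsP; exists m; rewrite !mem_iota; move: hb; clear.
    by case: m => a b /= hb; split=> //; rewrite add0n ltnS; lia.
  apply/allpairsP; exists n; rewrite !mem_iota; move: hb; clear.
  by case: n => a b /= hb; split=> //; rewrite add0n ltnS; lia.
rewrite (bigD1_seq (gdeg g)) ?undup_uniq //= eqxx big1 ?addr0 // => a /negPf.
by rewrite eq_sym => ->.
Qed.

Lemma steinberg_map_homog a :
  @steinberg_map k T @` textile_homog k T a = steinberg_homog k T a.
Proof.
apply/seteqP; split=> [_ [z hz <-]|f [hf fa]].
  split; first exact: steinberg_map_steinberg.
  by move=> g; exact: (homog_support hT hE hp hz).
have [N hN] := steinberg_tame hf; have [z hz zE] := tame_component a hN.
exists z => //; apply/funext => g; rewrite zE; case: eqP => // h.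
by apply/esym/eqP; apply: contrapT => /negP /fa.
Qed.
End Surjectivity.

Theorem corollary5p4 (k : fieldType) (T : textile_system)
    (hT : left_resolving T) (hE : sink_free (tE T))
    (hp : surjective_hom (tp T)) :
  exists phi : {linear textile_algebra k T -> (textile_groupoid T -> k^o)},
    [/\ set_bij [set: textile_algebra k T] (steinberg_algebra k T) phi,
        forall x y, phi (textile_mul x y) = convolution (phi x) (phi y)
      & forall a : int * int,
          phi @` textile_homog k T a = steinberg_homog k T a].
Proof.
pose phi : {linear textile_algebra k T -> (textile_groupoid T -> k^o)} :=
  HB.pack (@steinberg_map k T)
    (GRing.isLinear.Build k (textile_algebra k T) (textile_groupoid T -> k^o) *:%R
      (@steinberg_map k T) (steinberg_map_linear hT)).
exists phi; split.
- split.
  + by move=> z _; exact: steinberg_map_steinberg.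
  + by move=> y z _ _; exact: steinberg_map_inj.
  + by move=> f /(steinberg_map_surj hT hE hp)[z <-]; exists z.
- exact: steinberg_map_mul.
- exact: steinberg_map_homog.
Qed.
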